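(* Let $k \geq 1$ be a fixed integer and $R$ a fixed finite abelian group, and let $\omega(n)$ be any function with $\omega(n) \to \infty$ as $n\to\infty$. For $Y$ drawn from $Y_k(n,p)$, $$\lim_{n \to \infty} \Pr\big[\, H^{k-1}(Y;R)=0 \,\big]= \begin{cases} 0 & \text{if } p=\frac{k\log n -\omega(n)}{n}, \\ 1 & \text{if } p=\frac{k\log n+ \omega(n)}{n}. \end{cases}$$
   Context: $\log$ is the natural logarithm. $\Delta_{n-1}$ is the $(n-1)$-dimensional simplex on vertex set $[n]=\{1,\dots,n\}$; for a simplicial complex $X$, $X^{(k)}$ is its $k$-skeleton (all faces of dimension $\le k$) and $f_k(X)$ is the number of $k$-dimensional faces of $X$. $Y_k(n,p)$ is the probability space of all complexes $Y$ with $\Delta_{n-1}^{(k-1)} \subset Y \subset \Delta_{n-1}^{(k)}$, with $\Pr(Y)=p^{f_k(Y)}(1-p)^{\binom{n}{k+1}-f_k(Y)}$ (i.e. start from the full $(k-1)$-skeleton and add each $k$-simplex independently with probability $p$). For a complex $X$ on vertex set $V$, a $j$-cochain ($j\ge 0$) is an $R$-valued function on ordered $j$-simplices of $X$ that is skew-symmetric under permutation of the vertices; $C^j(X)$ is the group of $j$-cochains, with coboundary $d_j\phi([v_0,\dots,v_{j+1}])=\sum_{i=0}^{j+1}(-1)^i\phi([v_0,\dots,\widehat{v_i},\dots,v_{j+1}])$. The complex is augmented by $C^{-1}(X)=R$ with $d_{-1}a(v)=a$ for all $a\in R$, $v\in V$. $H^{j}(X;R)=\ker d_j/\operatorname{Im}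 d_{j-1}$ is the $j$-th reduced cohomology group with coefficients in $R$.
   Formalization: The group R is assumed nontrivial (for R = 0 the cohomology always vanishes, so the first limit would be 1, not 0), and in each case p is assumed to lie in [0,1] for all sufficiently large n, so that Y_k(n,p) is a probability space. *)

(* Defs.v *)
From HB Require Import structures.
From mathcomp Require Import all_boot all_order all_algebra all_fingroup.
From mathcomp Require Import all_classical all_reals all_analysis.
Set Implicit Arguments. Unset Strict Implicit. Unset Printing Implicit Defensive.
Import Order.TTheory GRing.Theory Num.Theory.
Local Open Scope ring_scope.

(* A simplicial complex on vertex set 'I_n is given by its face predicate.
   An ordered face with m vertices (dimension m-1) is an m-tuple of
   distinct vertices whose underlying set is a face.  m = 0 corresponds to
   the empty face, which gives the augmentation C^{-1} = G. *)
Definition ordered_face (n m : nat) (X : pred {set 'I_n}) (t : m.-tuple 'I_n) : bool :=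
  uniq t && X [set x in t].

(* (m-1)-cochains with coefficients in G: functions on ordered (m-1)-faces
   (extended by 0 elsewhere), skew-symmetric under vertex permutations. *)
Definition cochain (n m : nat) (X : pred {set 'I_n}) (G : zmodType)
    (phi : m.-tuple 'I_n -> G) : Prop :=
  (forall t, ~~ ordered_face X t -> phi t = 0) /\
  (forall (t : m.-tuple 'I_n) (s : 'S_m),
      phi [tuple tnth t (s i) | i < m] = if odd_perm s then - phi t else phi t).

Definition del_vertex (n m : nat) (t : m.+1.-tuple 'I_n) (i : 'I_m.+1) : m.-tuple 'I_n :=
  [tuple tnth t (lift i j) | j < m].

Definition coboundary (n m : nat) (G : zmodType) (phi : m.-tuple 'I_n -> G)
    (t : m.+1.-tuple 'I_n) : G :=
  \sum_(i < m.+1) (if odd i then - phi (del_vertex t i) else phi (del_vertex t i)).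

Definition reduced_cohomology_vanishes (n : nat) (X : pred {set 'I_n})
    (G : zmodType) (j : nat) : Prop :=
  forall phi : j.+1.-tuple 'I_n -> G,
    cochain X phi ->
    (forall t : j.+2.-tuple 'I_n, ordered_face X t -> coboundary phi t = 0) ->
    exists psi : j.-tuple 'I_n -> G,
      cochain X psi /\
      forall t : j.+1.-tuple 'I_n, ordered_face X t -> coboundary psi t = phi t.

(* The complex Y with full (k-1)-skeleton and set K of k-faces. *)
Definition Ycomplex (n k : nat) (K : {set {set 'I_n}}) : pred {set 'I_n} :=
  fun S => (#|S| <= k)%N || (S \in K).

Definition Yprob (R : realType) (n k : nat) (p : R)
    (E : {set {set 'I_n}} -> bool) : R :=
  \sum_(K : {set {set 'I_n}} |
        (K \subset [set S : {set 'I_n} | #|S| == k.+1]) && E K)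
    p ^+ #|K| * (1 - p) ^+ ('C(n, k.+1) - #|K|).

Definition Pr_Hkm1_vanishes (R : realType) (G : zmodType) (n k : nat) (p : R) : R :=
  @Yprob R n k p (fun K => `[< reduced_cohomology_vanishes (Ycomplex k K) G k.-1 >]).

(* Main.v *)
Require Import Defs.
From HB Require Import structures.
From mathcomp Require Import all_boot all_order all_algebra all_fingroup.
From mathcomp Require Import all_classical all_reals all_analysis.
From mathcomp Require Import zify ring lra.
Set Implicit Arguments. Unset Strict Implicit. Unset Printing Implicit Defensive.
(* The finite-set lemmas take precedence over their namesakes on classical sets. *)
Import boot.fintype boot.finset.
Import Order.TTheory GRing.Theory Num.Theory.
Import numFieldNormedType.Exports.
Local Open Scope ring_scope.

(** For a cochain [phi] on [k]-sets let [b] be the number of [(k+1)]-sets in the support of [d phi]: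
    then [phi] is a cocycle of [Y] with probability [(1 - p)^b].

    Subcritical range: a [k]-set contained in no face of [Y] carries a cocycle that is not a
    coboundary, and by the second moment method such isolated sets exist.

    Supercritical range: if the cohomology is non-zero there is a cocycle [phi <> 0] whose support
    [A] is smallest in its class, and the union bound runs over these, grouped by [m = #|A|].
    Subtracting cones shows [n m <= (k+1) b]. A [(k+1)]-set with exactly one face in [A] lies in the
    support of [d phi], so [b >= m (n - k - m)], which suffices when [m <= n / (4k(k+1)) =: d].
    For [m > d], choose greedily [m/d + 1] members of [A] whose neighbourhoods cover all of [A] except
    a set [U] such that every member of [A] has at most [d] neighbours in [U]. The covered part of [A]
    costs only a factor [C^m] in the counting, and [u = #|U|] satisfies [b >= u (n - k) - m d].
    If [2(k+1)u <= m] the first bound on [b] beats the [binom(n,k)^u] choices for [U]; otherwise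
    the last one beats the [(C n^(k-1))^u] choices. *)

(** * Cochains on tuples of vertices *)

Section Cochains.
Variables (n : nat) (G : zmodType).
Implicit Types v : 'I_n.

(** These are the cochains of the full simplex. In the degrees where every face is present in [Y]
    they coincide with the cochains of [Y], so they can be handled without reference to the random
    set. *)
Definition alternating_cochain m (phi : m.-tuple 'I_n -> G) : Prop :=
  (forall t : m.-tuple 'I_n, ~~ uniq t -> phi t = 0) /\
  (forall (t : m.-tuple 'I_n) (s : 'S_m),
      phi [tuple tnth t (s i) | i < m] = if odd_perm s then - phi t else phi t).

Definition cone m v (phi : m.+1.-tuple 'I_n -> G) : m.-tuple 'I_n -> G :=
  fun t => phi [tuple of v :: t].

Lemma eq_coboundary m (phi psi : m.-tuple 'I_n -> G) :
  phi =1 psi -> coboundary phi =1 coboundary psi.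
Proof. by move=> e t; apply: eq_bigr => i _; rewrite !e. Qed.

Lemma coboundaryB m (phi psi : m.-tuple 'I_n -> G) t :
  coboundary (fun s : m.-tuple 'I_n => phi s - psi s) t = coboundary phi t - coboundary psi t.
Proof.
rewrite /coboundary -sumrB; apply: eq_bigr => i _.
by case: (odd i); rewrite // !opprD.
Qed.

Lemma coboundaryD m (phi psi : m.-tuple 'I_n -> G) t :
  coboundary (fun s : m.-tuple 'I_n => phi s + psi s) t = coboundary phi t + coboundary psi t.
Proof.
rewrite /coboundary -big_split; apply: eq_bigr => i _ /=.
by case: (odd i); rewrite // !opprD.
Qed.

Lemma del_vertex0 m v (t : m.-tuple 'I_n) :
  del_vertex [tuple of v :: t] ord0 = t.
Proof.
apply: eq_from_tnth => i; rewrite tnth_mktuple.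
by rewrite !(tnth_nth v).
Qed.

Lemma tnth_cons_lift0 m v (t : m.-tuple 'I_n) i :
  tnth [tuple of v :: t] (lift ord0 i) = tnth t i.
Proof. by rewrite !(tnth_nth v) [nat_of_ord (lift _ _)]lift0. Qed.

Lemma del_vertexS m v (t : m.+1.-tuple 'I_n) i :
  del_vertex [tuple of v :: t] (lift ord0 i) = [tuple of v :: del_vertex t i].
Proof.
apply: eq_from_tnth => j; rewrite tnth_mktuple.
case: (unliftP ord0 j) => [j'|] -> //.
rewrite tnth_cons_lift0 tnth_mktuple -(tnth_cons_lift0 v t); apply: (congr1 (tnth [tuple of v :: t])).
by apply: val_inj; rewrite /= /bump /= !add1n ltnS addnS.
Qed.

(** Homotopy formula: [cone v] is a contraction of the full simplex. Deleting the head gives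
    [phi t]; every other deletion keeps [v] in front and shifts the sign. *)
Lemma coboundary_cons m (phi : m.+1.-tuple 'I_n -> G) v (t : m.+1.-tuple 'I_n) :
  coboundary phi [tuple of v :: t] = phi t - coboundary (cone v phi) t.
Proof.
rewrite /coboundary big_ord_recl /= del_vertex0; congr (_ + _).
rewrite -sumrN; apply: eq_bigr => i _.
rewrite del_vertexS add0n.
by case: (odd i); rewrite //= opprK.
Qed.

Lemma coboundary_cons0 (phi : 0.-tuple 'I_n -> G) t :
  coboundary phi t = phi [tuple].
Proof. by rewrite /coboundary big_ord_recl big_ord0 addr0 [del_vertex _ _]tuple0. Qed.

(** Induction through the homotopy formula: the cone of [d phi] is [phi - d (cone v phi)], whose
    coboundary is [d phi] by the induction hypothesis. *)
Lemma coboundary_coboundary m (phi : m.-tuple 'I_n -> G) t :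
  coboundary (coboundary phi) t = 0.
Proof.
elim: m phi t => [|m IH] phi t.
  case/tupleP: t => v t; rewrite coboundary_cons coboundary_cons0.
  by rewrite [X in _ - X]coboundary_cons0 /cone coboundary_cons0 subrr.
case/tupleP: t => v t; rewrite coboundary_cons.
rewrite [X in _ - X](eq_coboundary (psi := fun s : m.+1.-tuple 'I_n => phi s - coboundary (cone v phi) s)).
  by rewrite coboundaryB IH subr0 subrr.
by move=> s; rewrite /cone coboundary_cons.
Qed.

Lemma lift_perm_surj m (s : 'S_m.+1) i :
  exists s', s = lift_perm i (s i) s'.
Proof.
have ne j : i != lift i j by apply: neq_lift.
have sne j : s i != s (lift i j) by rewrite (inj_eq perm_inj).
pose f j := odflt j (unlift (s i) (s (lift i j))).
have fE j : lift (s i) (f j) = s (lift i j).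
  by rewrite /f; case: unliftP (sne j) => [j' ->|->] //=; rewrite eqxx.
have f_inj : injective f.
  move=> j j' /(congr1 (lift (s i))); rewrite !fE => /perm_inj.
  exact: lift_inj.
exists (perm f_inj); apply/permP => j.
case: (unliftP i j) => [j'|] ->; first by rewrite lift_perm_lift permE fE.
by rewrite lift_perm_id.
Qed.

(** Deleting position [i] of the permuted tuple is a permutation of deleting position [s i] of [t].
    Its parity differs from that of [s] by the parities of [i] and [s i], so reindexing by [s]
    matches the two sums. *)
Lemma coboundary_perm m (phi : m.-tuple 'I_n -> G) (t : m.+1.-tuple 'I_n) (s : 'S_m.+1) :
  alternating_cochain phi ->
  coboundary phi [tuple tnth t (s i) | i < m.+1] =
  if odd_perm s then - coboundary phi t else coboundary phi t.
Proof.
move=> [_ skew].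
have E (i : 'I_m.+1) : (if odd i then - phi (del_vertex [tuple tnth t (s i) | i < m.+1] i)
    else phi (del_vertex [tuple tnth t (s i) | i < m.+1] i)) =
    (if odd_perm s then - (if odd (s i) then - phi (del_vertex t (s i))
       else phi (del_vertex t (s i))) else 
       (if odd (s i) then - phi (del_vertex t (s i))
       else phi (del_vertex t (s i)))).
  have [s' es] := lift_perm_surj s i.
  have -> : del_vertex [tuple tnth t (s i) | i < m.+1] i =
            [tuple tnth (del_vertex t (s i)) (s' j) | j < m].
    apply: eq_from_tnth => j; rewrite !tnth_mktuple.
    by congr (tnth t _); rewrite {1}es lift_perm_lift.
  have -> : odd_perm s = odd i (+) odd (s i) (+) odd_perm s'.
    by rewrite [in LHS]es odd_lift_perm.
  rewrite skew.
  by case: (odd i); case: (odd (s i)); case: (odd_perm s'); rewrite /= ?opprK.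
rewrite /coboundary (eq_bigr _ (fun i _ => E i)).
rewrite [in RHS](reindex_inj (@perm_inj _ s)) /=.
by case: (odd_perm s); rewrite ?sumrN.
Qed.

Lemma uniq_tuple_perm m (t : m.-tuple 'I_n) (s : 'S_m) :
  uniq [tuple tnth t (s i) | i < m] = uniq t.
Proof. by apply: perm_uniq; apply/tuple_permP; exists s. Qed.

Lemma alternating_coboundary m (phi : m.-tuple 'I_n -> G) :
  alternating_cochain phi -> alternating_cochain (coboundary phi).
Proof.
move=> alt; split=> [t nut|t s]; last exact: coboundary_perm.
(* With 2-torsion in [G], skew-symmetry does not force vanishing on repeated vertices. So the
   repeated vertex is moved to the two front places: the first two terms cancel and all others still
   contain it twice. *)
have : exists t' : m.+1.-tuple 'I_n, perm_eq t t' /\ coboundary phi t' = 0.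
  have [v [r tE]] : exists v, exists r, perm_eq t (v :: v :: r).
    elim: (tval t) nut => //= x r IH; rewrite negb_and negbK.
    case/orP => [xr|/IH [v [r' e]]].
      by exists x, (rem x r); rewrite perm_cons perm_to_rem.
    exists v, (x :: r'); rewrite -(perm_cons x) in e.
    apply: perm_trans e _.
    by rewrite -[x :: v :: _]/([:: x] ++ [:: v; v] ++ r') perm_catCA.
  have sz : size (v :: v :: r) == m.+1 by rewrite -(perm_size tE) size_tuple.
  exists (Tuple sz); split=> //.
  case: m phi alt t nut tE sz => [//|m] phi alt t _ _ sz.
  have szr : size r == m by [].
  case: m phi alt t sz szr => [|m] phi alt t sz szr.
    have -> : Tuple sz = [tuple of v :: [tuple of v :: Tuple szr]] by exact: val_inj.
    rewrite coboundary_cons coboundary_cons0 /cone.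
    by rewrite [Tuple szr]tuple0 /= subrr.
  have -> : Tuple sz = [tuple of v :: [tuple of v :: Tuple szr]] by exact: val_inj.
  rewrite coboundary_cons coboundary_cons {1}/cone opprB addrCA subrr addr0.
  rewrite /coboundary big1 // => i _; rewrite /cone alt.1 ?oppr0 ?if_same //=.
  by rewrite mem_head.
case=> t' [/tuple_permP [s ts] e0].
have {ts} -> : t = [tuple tnth t' (s i) | i < m.+1] by exact: val_inj.
by rewrite coboundary_perm // e0 oppr0 if_same.
Qed.

Lemma alternatingB m (phi psi : m.-tuple 'I_n -> G) :
  alternating_cochain phi -> alternating_cochain psi -> alternating_cochain (fun t : m.-tuple 'I_n => phi t - psi t).
Proof.
move=> [z1 s1] [z2 s2]; split=> [t ut|t s]; first by rewrite z1 ?z2 ?subr0.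
by rewrite s1 s2; case: odd_perm; rewrite // !opprD.
Qed.

Lemma alternating_cone m v (phi : m.+1.-tuple 'I_n -> G) :
  alternating_cochain phi -> alternating_cochain (cone v phi).
Proof.
move=> [z sk]; split=> [t ut|t s].
  by apply: z => /=; rewrite negb_and ut orbT.
rewrite /cone; have := sk [tuple of v :: t] (lift_perm ord0 ord0 s).
rewrite odd_lift_perm /= => <-; congr phi; apply: eq_from_tnth => i.
rewrite tnth_mktuple; case: (unliftP ord0 i) => [j|] ->.
  by rewrite lift_perm_lift !tnth_cons_lift0 tnth_mktuple.
by rewrite lift_perm_id !(tnth_nth v).
Qed.

Definition face_support m (phi : m.-tuple 'I_n -> G) : {set {set 'I_n}} :=
  [set [set x in t] | t : m.-tuple 'I_n & uniq t && (phi t != 0)].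

Lemma face_supportP m (phi : m.-tuple 'I_n -> G) S :
  reflect (exists t : m.-tuple 'I_n, [/\ uniq t, phi t != 0 & S = [set x in t]])
          (S \in face_support phi).
Proof.
apply: (iffP imsetP) => [[t]|[t [ut pt ->]]].
  by rewrite inE => /andP[ut pt] ->; exists t.
by exists t; rewrite // inE ut.
Qed.

Lemma card_tuple_set m (t : m.-tuple 'I_n) : uniq t -> #|[set x in t]| = m.
Proof. by move=> ut; rewrite cardsE (card_uniqP ut) size_tuple. Qed.

Lemma card_face_support m (phi : m.-tuple 'I_n -> G) S :
  S \in face_support phi -> #|S| = m.
Proof. by case/face_supportP => t [ut _ ->]; rewrite card_tuple_set. Qed.

Lemma same_set_perm m (t t' : m.-tuple 'I_n) :
  uniq t -> uniq t' -> [set x in t] = [set x in t'] ->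
  exists s : 'S_m, t = [tuple tnth t' (s i) | i < m].
Proof.
move=> ut ut' /setP e.
have /tuple_permP [s ts] : perm_eq t t'.
  by apply: uniq_perm => // x; have := e x; rewrite !inE.
by exists s; apply: val_inj.
Qed.

Lemma mem_face_support m (phi : m.-tuple 'I_n -> G) (t : m.-tuple 'I_n) :
  alternating_cochain phi -> uniq t -> ([set x in t] \in face_support phi) = (phi t != 0).
Proof.
move=> alt ut; apply/face_supportP/idP => [[t' [ut' pt' /esym e]]|pt].
  have [s ts] := same_set_perm ut' ut e.
  move: pt'; rewrite ts alt.2.
  by case: odd_perm; rewrite // oppr_eq0.
by exists t.
Qed.

Lemma face_support0 m (phi : m.-tuple 'I_n -> G) t :
  alternating_cochain phi -> face_support phi = set0 -> phi t = 0.
Proof.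
move=> alt s0; case: (boolP (uniq t)) => [ut|/alt.1 //].
by apply/eqP; rewrite -[_ == _]negbK -mem_face_support // s0 inE.
Qed.

Definition minimal_cochain m (phi : m.+1.-tuple 'I_n -> G) : Prop :=
  forall psi, alternating_cochain psi ->
    (#|face_support phi| <= #|face_support (fun t : m.+1.-tuple 'I_n => phi t - coboundary psi t)%R|)%N.

(* Subtracting the coboundary of the cone at [v] from [phi] leaves the link of [v] in [d phi];
   then sum over [v]. *)
Lemma minimal_expansion m (phi : m.+1.-tuple 'I_n -> G) :
  alternating_cochain phi -> minimal_cochain phi ->
  (n * #|face_support phi| <= m.+2 * #|face_support (coboundary phi)|)%N.
Proof.
move=> alt mini.
have le v : (#|face_support phi| <= #|[set T in face_support (coboundary phi) | v \in T]|)%N.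
  apply: leq_trans (mini (cone v phi) (alternating_cone v alt)) _.
  set psi := fun t : m.+1.-tuple 'I_n => _.
  have psiE (t : m.+1.-tuple 'I_n) : psi t = coboundary phi [tuple of v :: t] by rewrite coboundary_cons.
  have H S : S \in face_support psi -> (v \notin S) && (v |: S \in face_support (coboundary phi)).
    case/face_supportP => t [ut]; rewrite psiE => pt ->.
    have alt' := alternating_coboundary alt.
    have uvt : uniq (v :: t) by apply: contraNT pt => /(alt'.1 [tuple of v :: t]) ->.
    rewrite inE; have /andP[-> _] := uvt.
    have -> : v |: [set x in t] = [set x in [tuple of v :: t]].
      by apply/setP => x; rewrite !inE.
    by rewrite mem_face_support.
  rewrite -(card_in_imset (f := fun S => v |: S) (D := mem (face_support psi))).
    apply/subset_leq_card/subsetP => T /imsetP [S /H /andP[_ ST] ->].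
    by rewrite inE ST !inE eqxx.
  move=> S S' /H /andP[vS _] /H /andP[vS' _] /(congr1 (fun T => T :\ v)).
  by rewrite !setU1K.
have : (\sum_(v < n) #|face_support phi| <=
   \sum_(v < n) #|[set T in face_support (coboundary phi) | v \in T]|)%N.
  by apply: leq_sum => v _.
rewrite sum_nat_const card_ord => /leq_trans; apply.
under eq_bigr => v _ do rewrite -sum1dep_card big_mkcondr /=.
rewrite exchange_big /= mulnC -sum_nat_const; apply: leq_sum => T TS.
by rewrite -big_mkcond sum1_card (card_face_support TS).
Qed.

End Cochains.

(** * Families of k-sets *)

Lemma card_bigcup_le (I T : finType) (P : pred I) (F : I -> {set T}) :
  (#|\bigcup_(i | P i) F i| <= \sum_(i | P i) #|F i|)%N.
Proof.
elim/big_rec2: _ => [|i m B _ le]; first by rewrite cards0.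
by rewrite (leq_trans (leq_card_setU _ _)) // leq_add2l.
Qed.

Section Families.
Local Open Scope nat_scope.
Variables (n k : nat).
Implicit Types (S : {set 'I_n}) (A U : {set {set 'I_n}}).

Definition ksets m : {set {set 'I_n}} := [set S : {set 'I_n} | #|S| == m].

Lemma card_ksets m : #|ksets m| = 'C(n, m).
Proof. by rewrite card_draws card_ord. Qed.

(** For [S] of size [k] this is adjacency in the Johnson graph: two [k]-sets sharing [k - 1]
    elements. *)
Definition neighbours S : {set {set 'I_n}} :=
  [set S' : {set 'I_n} | (#|S'| == k) && (#|S :|: S'| == k.+1)].

Definition cofaces S : {set {set 'I_n}} := [set T : {set 'I_n} | (#|T| == k.+1) && (S \subset T)].

(** When [A] is the support of a cochain, just one term of its coboundary survives on such a [T], so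
    no cancellation can occur there. *)
Definition sole_cofaces A : {set {set 'I_n}} :=
  [set T : {set 'I_n} | (#|T| == k.+1) && (#|[set S in A | S \subset T]| == 1)].

Lemma card_cofaces S : #|S| = k -> #|cofaces S| = n - k.
Proof.
move=> cS; have <- : #|~: S| = n - k by rewrite cardsCs setCK card_ord cS.
rewrite -(card_in_imset (f := fun x => x |: S) (D := mem (~: S))).
  congr #|pred_of_set _|; apply/setP => T; rewrite inE; apply/idP/imsetP.
    case/andP => /eqP cT ST.
    have : #|T :\: S| == 1 by rewrite cardsD (setIidPr ST) cT cS subSnn.
    case/cards1P => x ex; exists x.
      by have := set11 x; rewrite -ex !inE => /andP[].
    by rewrite -ex setUC -{1}(setID T S) (setIidPr ST).
  case=> x; rewrite inE => xS ->.
  by rewrite cardsU1 xS cS subsetUr add1n eqxx.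
move=> x y; rewrite !inE => xS yS /setP /(_ x).
by rewrite !inE eqxx (negPf xS) /= orbF => /esym/eqP.
Qed.

(** A neighbour arises by exchanging some [x] in [S] for a vertex [y]. *)
Lemma card_neighbours S : #|S| = k -> #|neighbours S| <= k * n.
Proof.
move=> cS.
have sub : neighbours S \subset [set y |: (S :\ x) | x in S, y in [set: 'I_n]].
  apply/subsetP => S'; rewrite inE => /andP[/eqP cS' /eqP cU].
  have cI : #|S :&: S'|.+1 = k.
    by have := cardsUI S S'; rewrite cU cS cS'; lia.
  have /cards1P [x ex] : #|S :\: S'| == 1 by rewrite cardsD cS -cI subSnn.
  have /cards1P [y ey] : #|S' :\: S| == 1 by rewrite cardsD cS' setIC -cI subSnn.
  apply/imset2P; exists x y => //.
    by have := set11 x; rewrite -ex !inE => /andP[].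
  rewrite -ex -ey setDDr setDv set0U -{1}(setID S' S) setUC.
  by rewrite [S' :&: S]setIC.
apply: leq_trans (subset_leq_card sub) _.
by rewrite curry_imset2X (leq_trans (leq_imset_card _ _)) // cardsX cS cardsT card_ord.
Qed.

(** The union of two distinct [k]-sets already has at least [k + 1] elements, so it fills any common
    coface. Hence two such sets share at most one coface. *)
Lemma coface_setU S S' T : #|S| = k -> #|S'| = k -> S' != S ->
  T \in cofaces S -> T \in cofaces S' -> T = S :|: S'.
Proof.
rewrite !inE => cS cS' ne /andP[/eqP cT ST] /andP[_ S'T].
apply/esym/eqP; rewrite eqEcard subUset ST S'T cT /= ltnNge.
apply: contraNN ne => le; rewrite eqEcard cS cS' leqnn andbT.
suff <- : S :|: S' = S by exact: subsetUr.
by apply/esym/eqP; rewrite eqEcard subsetUl cS.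
Qed.

(* A coface of [S \in U] that contains another member [S'] of [A] equals [S :|: S'];
   hence at most [#|A| * e] of the cofaces of members of [U] are not sole. *)
Lemma sole_cofaces_lb A U e :
  A \subset ksets k -> U \subset A ->
  (forall S, S \in A -> #|neighbours S :&: U| <= e) ->
  #|U| * (n - k) <= #|sole_cofaces A| + #|A| * e.
Proof.
move=> Ak UA deg.
have card_A S : S \in A -> #|S| = k by move=> /(subsetP Ak); rewrite inE => /eqP.
pose P := [set x : {set 'I_n} * {set 'I_n} | (x.1 \in U) && (x.2 \in cofaces x.1)].
pose Q := [set x : {set 'I_n} * {set 'I_n} | (x.1 \in A) && (x.2 \in neighbours x.1 :&: U)].
have -> : #|U| * (n - k) = #|P|.
  rewrite -[RHS]sum1_card (eq_bigl (fun x => (x.1 \in U) && (x.2 \in cofaces x.1))); last first.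
    by move=> x; rewrite inE.
  rewrite -(pair_big_dep (mem U) (fun S => mem (cofaces S)) (fun _ _ => 1)) /=.
  rewrite -sum_nat_const; apply: eq_bigr => S SU.
  by rewrite sum1_card card_cofaces // card_A // (subsetP UA).
have : #|Q| <= #|A| * e.
  rewrite -sum1_card (eq_bigl (fun x => (x.1 \in A) && (x.2 \in neighbours x.1 :&: U))); last first.
    by move=> x; rewrite inE.
  rewrite -(pair_big_dep (mem A) (fun S => mem (neighbours S :&: U)) (fun _ _ => 1)) /=.
  rewrite -sum_nat_const; apply: leq_sum => S SA.
  by rewrite sum1_card deg.
move=> cQ; apply: leq_trans (leq_add (leqnn _) cQ).
pose P1 := [set x in P | x.2 \in sole_cofaces A].
have -> : #|P| = #|P1| + #|P :\: P1|.
  by rewrite -(cardsID P1 P); congr (#|pred_of_set _| + _); apply/setIidPr/subsetP => x; rewrite inE => /andP[].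
apply: leq_add.
  rewrite -(card_in_imset (f := snd) (D := mem P1)).
    apply/subset_leq_card/subsetP => T /imsetP[x].
    by rewrite inE => /andP[_ xs] ->.
  move=> [S T] [S' T'] /=; rewrite !inE /= => /andP[/andP[SU /andP[_ ST]] /andP[_ sole]].
  move=> /andP[/andP[S'U /andP[_ ST']] _] eT; rewrite -eT in ST' *.
  case/cards1P: sole => S0 /setP e0.
  have := e0 S; have := e0 S'; rewrite !inE ST ST' !(subsetP UA) //=.
  by move=> /esym/eqP-> /esym/eqP->.
(* The map sends [(S', S)] to [(S, S :|: S')]; it reaches every pair of [P] whose coface contains a
   second member of [A]. *)
apply: leq_trans (leq_imset_card (fun x => (x.2, x.2 :|: x.1)) Q).
apply/subset_leq_card/subsetP => -[S T]; rewrite !inE /=.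
move=> /andP[] /[swap] /andP[SU /andP[cT ST]]; rewrite SU cT ST /= => nsole.
have SA := subsetP UA S SU.
have [S' [S'A S'T neS]] : exists S', [/\ S' \in A, S' \subset T & S' != S].
  have [/exists_inP [S' S'A /andP[]]|] := boolP [exists S' in A, (S' \subset T) && (S' != S)].
    by exists S'.
  rewrite negb_exists_in => /forall_inP H; case/negP: nsole.
  apply/cards1P; exists S; apply/setP => S'; rewrite !inE.
  apply/andP/eqP => [[S'A S'T]|-> //].
  by have := H S' S'A; rewrite S'T negbK => /eqP.
have TE : T = S :|: S' by apply: coface_setU; rewrite ?card_A // inE cT.
apply/imsetP; exists (S', S); last by rewrite /= TE.
rewrite !inE /= S'A SU card_A // eqxx /= andbT setUC -TE.
exact: cT.
Qed.

Definition covered j (s : 'I_j -> {set 'I_n}) : {set {set 'I_n}} :=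
  \bigcup_i neighbours (s i).

(* Greedy choice: as long as some neighbourhood contains more than [d] uncovered members of [A],
   add it; each step covers [d] new members, so this stops within [#|A| %/ d + 1] steps. *)
Lemma greedy_cover A d :
  0 < d -> A \subset ksets k -> A != set0 ->
  exists s : {ffun 'I_(#|A| %/ d).+1 -> {set 'I_n}},
    (forall i, s i \in A) /\
    (forall S, S \in A -> #|neighbours S :&: (A :\: covered s)| <= d).
Proof.
move=> d0 Ak /set0Pn [S0 S0A].
(* The induction over the length [j] carries an alternative. At [j = #|A| %/ d + 1] its first branch
   would cover more than [#|A|] members. *)
suff /(_ (#|A| %/ d).+1) [s [sA [le|//]]] j : exists s : {ffun 'I_j -> {set 'I_n}}, (forall i, s i \in A) /\
    (j * d <= #|A :&: covered s| \/
     forall S, S \in A -> #|neighbours S :&: (A :\: covered s)| <= d).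
  have := leq_trans le (subset_leq_card (subsetIl _ _)).
  by rewrite leqNgt ltn_ceil.
  by exists s.
elim: j => [|j [s [sA H]]].
  by exists [ffun=> S0]; split=> [i|]; [rewrite ffunE|left].
have ext S : S \in A -> exists s' : {ffun 'I_j.+1 -> {set 'I_n}},
    (forall i, s' i \in A) /\ covered s' = neighbours S :|: covered s.
  move=> SA; exists [ffun i => if unlift ord0 i is Some i' then s i' else S]; split.
    by move=> i; rewrite ffunE; case: unliftP.
  rewrite /covered big_ord_recl ffunE unlift_none; congr (_ :|: _).
  by apply: eq_bigr => i _; rewrite ffunE liftK.
(* Once the degrees are small, the sequence is padded with [S0] to reach the fixed length; covering
   more only lowers the degrees. *)
case: H => [le|deg]; last first.
  have [s' [s'A cov]] := ext S0 S0A; exists s'; split=> //; right=> S SA.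
  apply: leq_trans (deg S SA); apply/subset_leq_card/setIS/setDS.
  by rewrite cov subsetUr.
have [/exists_inP [S SA lt]|] := boolP [exists S in A, d < #|neighbours S :&: (A :\: covered s)|].
  have [s' [s'A cov]] := ext S SA; exists s'; split=> //; left.
  rewrite cov mulSn.
  apply: leq_trans (leq_add (ltnW lt) le) _; rewrite -cardsUI.
  rewrite [X in _ + X](_ : _ = 0) ?addn0; last first.
    by apply/eqP; rewrite cards_eq0; apply/eqP/setP => T; rewrite !inE; case: (T \in covered s); rewrite /= ?andbF.
  apply/subset_leq_card/subsetP => T; rewrite !inE.
  by case: (T \in A); case: (T \in covered s); rewrite ?andbF ?orbT ?orbF //= andbT.
rewrite negb_exists_in => /forall_inP deg.
have [s' [s'A cov]] := ext S0 S0A; exists s'; split=> //; right=> S SA.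
have := deg S SA; rewrite -leqNgt; apply: leq_trans; apply/subset_leq_card/setIS/setDS.
by rewrite cov subsetUr.
Qed.

(* [A] is recovered from [s], the subset [A :&: covered s] of [covered s], and the [u]-element rest. *)
Definition cover_code j u A : bool :=
  [exists s : {ffun 'I_j -> {set 'I_n}},
     [forall i, s i \in ksets k] && (#|A :\: covered s| == u)].

(** The factors count the centres, the subsets of a covered part with at most [j * (k * n)] members,
    and the rest. *)
Lemma card_cover_code j u :
  #|[set A : {set {set 'I_n}} | (A \subset ksets k) && cover_code j u A]| <=
  'C(n, k) ^ j * (2 ^ (j * (k * n)) * 'C('C(n, k), u)).
Proof.
pose F := [set s : {ffun 'I_j -> {set 'I_n}} | [forall i, s i \in ksets k]].
have cF : #|F| = 'C(n, k) ^ j.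
  rewrite -card_ksets -[in RHS](card_ord j) -card_ffun_on.
  by apply: eq_card => s; rewrite inE; apply/forallP/ffun_onP.
pose Us := [set U : {set {set 'I_n}} | (U \subset ksets k) && (#|U| == u)].
have cUs : #|Us| = 'C('C(n, k), u) by rewrite cards_draws card_ksets.
pose C (s : {ffun 'I_j -> {set 'I_n}}) := [set D :|: U | D in powerset (covered s), U in Us].
apply: (@leq_trans #|\bigcup_(s in F) C s|).
  apply/subset_leq_card/subsetP => A; rewrite inE => /andP[Ak /existsP[s /andP[sk cU]]].
  apply/bigcupP; exists s; first by rewrite inE.
  apply/imset2P; exists (A :&: covered s) (A :\: covered s).
  - by rewrite inE subsetIr.
  - by rewrite inE cU andbT (subset_trans (subsetDl _ _)).
  - by rewrite setID.
apply: leq_trans (card_bigcup_le _ _) _.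
rewrite -cF -sum_nat_const; apply: leq_sum => s; rewrite inE => /forallP sk.
rewrite /C curry_imset2X (leq_trans (leq_imset_card _ _)) // cardsX card_powerset cUs.
rewrite leq_mul2r leq_exp2l //; apply/orP; right.
apply: leq_trans (card_bigcup_le _ _) _.
rewrite -[X in X * _](card_ord j) -sum_nat_const; apply: leq_sum => i _.
by apply: card_neighbours; have := sk i; rewrite inE => /eqP.
Qed.

End Families.

(** * Obstructions to vanishing *)

Section Vanishing.
Variables (n k : nat) (G : zmodType) (K : {set {set 'I_n}}).
(** Here and in the union bound [k] is one less than in the theorem: the random faces have [k.+2]
    vertices and the cohomology in question has degree [k]. *)
Notation Y := (Ycomplex k.+1 K).
Notation vanishes := (reduced_cohomology_vanishes Y G k).

Lemma cochain_alternating m (phi : m.-tuple 'I_n -> G) :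
  (m <= k.+1)%N -> cochain Y phi <-> alternating_cochain phi.
Proof.
move=> mk; have E (t : m.-tuple 'I_n) : ordered_face Y t = uniq t.
  rewrite /ordered_face; case ut: (uniq t) => //=.
  by rewrite /Ycomplex card_tuple_set // mk.
by split=> -[z s]; split=> // t ut; apply: z; rewrite ?E // -E.
Qed.

Lemma ordered_face_top (t : k.+2.-tuple 'I_n) :
  ordered_face Y t = uniq t && ([set x in t] \in K).
Proof.
rewrite /ordered_face; case ut: (uniq t) => //=.
by rewrite /Ycomplex card_tuple_set // ltnn.
Qed.

(** Take a representative of a non-trivial class with the smallest support. It is non-zero because
    the class is, and being closed on [Y] means that its coboundary avoids [K]. *)
Lemma nonvanishing_minimal :
  ~ vanishes ->
  exists phi : k.+1.-tuple 'I_n -> G,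
    [/\ alternating_cochain phi, face_support phi != set0,
        [disjoint face_support (coboundary phi) & K] & minimal_cochain phi].
Proof.
move=> nv; have [phi0 H] : exists phi0 : k.+1.-tuple 'I_n -> G,
    ~ (cochain Y phi0 ->
    (forall t : k.+2.-tuple 'I_n, ordered_face Y t -> coboundary phi0 t = 0) ->
    exists psi : k.-tuple 'I_n -> G,
      cochain Y psi /\
      forall t : k.+1.-tuple 'I_n, ordered_face Y t -> coboundary psi t = phi0 t).
  by apply: contra_notP nv => /forallNP H phi; have /contrapT := H phi.
move/not_implyP: H => [/cochain_alternating alt0 /not_implyP [closed0 ex0]].
have {}alt0 := alt0 (leqnn _).
pose sub (psi : k.-tuple 'I_n -> G) (t : k.+1.-tuple 'I_n) := phi0 t - coboundary psi t.
pose P m := `[< exists psi, alternating_cochain psi /\ #|face_support (sub psi)| = m >].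
have exP : exists m, P m.
  exists #|face_support (sub (fun _ => 0))|; apply/asboolP; exists (fun _ => 0); split=> //.
  by split=> // t s; rewrite oppr0 if_same.
case: (ex_minnP exP) => m /asboolP [psi [altpsi pm]] mmin.
have altsub : alternating_cochain (sub psi).
  by apply: alternatingB => //; apply: alternating_coboundary.
exists (sub psi); split=> //.
- apply/eqP => s0; apply: ex0; exists psi; split.
    by apply/cochain_alternating.
  by move=> t _; apply/esym/eqP; rewrite -subr_eq0; apply/eqP/(face_support0 t altsub s0).
- rewrite disjoint_subset; apply/subsetP => T /face_supportP [t [ut dt ->]].
  rewrite inE; apply: contraNN dt => tK.
  rewrite /sub coboundaryB coboundary_coboundary subr0 closed0 //.
  by rewrite ordered_face_top ut.
- move=> psi' alt'; rewrite pm; apply: mmin; apply/asboolP.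
  exists (fun t : k.-tuple 'I_n => psi t + psi' t); split.
    have altN : alternating_cochain (fun t : k.-tuple 'I_n => - psi' t).
      case: alt' => z s; split=> [t ut|t r]; first by rewrite z // oppr0.
      by rewrite s; case: odd_perm.
    have := alternatingB altpsi altN; congr (alternating_cochain _).
    by apply/funext => t; rewrite opprK.
  congr #|pred_of_set (face_support _)|; apply/funext => t.
  rewrite /sub -addrA -opprD; congr (_ - _).
  by rewrite -coboundaryD.
Qed.

End Vanishing.

Section Isolated.
Variables (n k : nat) (G : zmodType).

(** The cochain with value [g] on one ordering of [S], zero off [S], is closed on [Y] because no
    face of [K] contains [S]. A primitive would make it closed on the full simplex as well, where
    adding a vertex outside [S] gives the value [g]. *)
Lemma isolated_nonvanishing (K : {set {set 'I_n}}) (S : {set 'I_n}) (g : G) :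
  g != 0 -> #|S| = k.+1 -> (k.+1 < n)%N -> (forall T, T \in K -> ~~ (S \subset T)) ->
  ~ reduced_cohomology_vanishes (Ycomplex k.+1 K) G k.
Proof.
move=> g0 cS kn iso van.
have szt0 : size (enum S) == k.+1 by rewrite -cardE cS.
pose t0 : k.+1.-tuple 'I_n := Tuple szt0.
have ut0 : uniq t0 by exact: enum_uniq.
(* At most one permutation contributes, as [t0] has distinct entries; the sum is the alternating
   extension of [g] at [t0]. *)
pose phi (t : k.+1.-tuple 'I_n) : G :=
  \sum_(s : 'S_k.+1 | t == [tuple tnth t0 (s i) | i < k.+1]) (if odd_perm s then - g else g).
have t0E : [tuple tnth t0 ((1%g : 'S_k.+1) i) | i < k.+1] = t0.
  by apply: eq_from_tnth => i; rewrite tnth_mktuple perm1.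
have phi_t0 : phi t0 = g.
  rewrite /phi (big_pred1 1%g) ?odd_perm1 // => s /=; apply/eqP/eqP => [e|->//].
  apply/permP => i; rewrite perm1; apply: val_inj => /=; apply/eqP.
  rewrite -(nth_uniq (tnth_default t0 i) _ _ ut0) ?size_tuple ?ltn_ord //.
  rewrite -!tnth_nth; apply/eqP.
  by rewrite [in RHS]e tnth_mktuple.
have phi_out (t : k.+1.-tuple 'I_n) x : phi t != 0 -> (x \in t) = (x \in S).
  apply: contraNeq => ne; rewrite /phi big1 // => s /eqP ts; case/eqP: ne.
  have /perm_mem -> : perm_eq t t0 by apply/tuple_permP; exists s; rewrite ts.
  by rewrite mem_enum.
have alt : alternating_cochain phi.
  split=> [t ut|t r].
    rewrite /phi big1 // => s /eqP ts; case/negP: ut.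
    by rewrite ts uniq_tuple_perm.
  rewrite /phi (reindex_inj (mulgI r)) /=.
  have -> : (if odd_perm r then - phi t else phi t) =
     \sum_(s : 'S_k.+1 | t == [tuple tnth t0 (s i) | i < k.+1])
        (if odd_perm r then - (if odd_perm s then - g else g) else (if odd_perm s then - g else g)).
    by rewrite /phi; case: (odd_perm r); rewrite ?sumrN.
  apply: eq_big => [s|s _].
    have E : [tuple tnth t0 ((r * s)%g i) | i < k.+1] =
      [tuple tnth [tuple tnth t0 (s i) | i < k.+1] (r i) | i < k.+1].
      by apply: eq_from_tnth => i; rewrite !tnth_mktuple permM.
    rewrite E; apply/eqP/eqP => [e|-> //].
    apply: eq_from_tnth => i.
    have := congr1 (fun t : k.+1.-tuple 'I_n => tnth t (r^-1%g i)) e.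
    by rewrite !tnth_mktuple permKV.
  by rewrite odd_permM; case: (odd_perm r); case: (odd_perm s); rewrite ?opprK.
have [|t|psi [/cochain_alternating]] := van phi.
- exact/cochain_alternating.
- rewrite ordered_face_top => /andP[ut tK]; rewrite /coboundary big1 // => i _.
  have [->|pt] := eqVneq (phi (del_vertex t i)) 0; first by rewrite oppr0 if_same.
  case/negP: (iso _ tK); apply/subsetP => x; rewrite -(phi_out _ x pt) inE.
  by case/tnthP => j ->; rewrite tnth_mktuple mem_tnth.
have mk : (k <= k.+1)%N by [].
move=> /(_ mk) altpsi dpsi.
have dpsiE : coboundary psi =1 phi.
  move=> t; have [ut|nut] := boolP (uniq t).
    apply: dpsi; rewrite /ordered_face ut /= /Ycomplex card_tuple_set // leqnn.
    done.
  by rewrite alt.1 // (alternating_coboundary altpsi).1.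
have [v vS] : exists v, v \notin S.
  have : (0 < #|~: S|)%N by rewrite cardsCs setCK card_ord cS subn_gt0.
  by case/card_gt0P => v; rewrite inE; exists v.
have := coboundary_coboundary psi [tuple of v :: t0].
rewrite (eq_coboundary dpsiE) coboundary_cons phi_t0 /coboundary big1 ?subr0.
  by move=> g0'; rewrite g0' eqxx in g0.
move=> i _; rewrite /cone.
have [->|pt] := eqVneq (phi [tuple of v :: del_vertex t0 i]) 0; first by rewrite oppr0 if_same.
by have := phi_out _ v pt; rewrite (negPf vS) mem_head.
Qed.

(** Order [T] as [v :: t] with [t] spanning its only face in the support. All other faces contain
    [v], so [phi] vanishes on them and the coboundary equals [phi t]. *)
Lemma sole_cofaces_support (phi : k.+1.-tuple 'I_n -> G) :
  alternating_cochain phi ->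
  sole_cofaces k.+1 (face_support phi) \subset face_support (coboundary phi).
Proof.
move=> alt; apply/subsetP => T; rewrite inE => /andP[/eqP cT /cards1P [S e]].
have := set11 S; rewrite -e inE => /andP[Ssupp ST].
have /face_supportP [t [ut pt SE]] := Ssupp.
have cS := card_face_support Ssupp.
have /cards1P [v ev] : #|T :\: S| == 1%N by rewrite cardsD (setIidPr ST) cT cS subSnn.
have TE : T = [set x in [tuple of v :: t]].
  rewrite -(setID T S) (setIidPr ST) ev SE; apply/setP => x.
  by rewrite !inE orbC.
have uvt : uniq (v :: t).
  rewrite /= ut andbT; have := set11 v; rewrite -ev SE !inE => /andP[-> _] //.
rewrite TE mem_face_support //; last exact: alternating_coboundary.
rewrite coboundary_cons [X in _ - X](_ : _ = 0) ?subr0 //.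
rewrite /coboundary big1 // => i _; rewrite /cone.
set t' := [tuple of v :: del_vertex t i].
have [->|pt'] := eqVneq (phi t') 0; first by rewrite oppr0 if_same.
have ut' : uniq t' by apply: contraNT pt' => /alt.1 ->.
have : [set x in t'] \in [set S].
  rewrite -e inE mem_face_support // pt' TE; apply/subsetP => x; rewrite !inE.
  case/orP => [->//|/tnthP [j ->]]; apply/orP; right.
  by rewrite tnth_mktuple mem_tnth.
rewrite inE => /eqP /setP /(_ v); rewrite !inE eqxx /= => /esym vS.
by move: uvt; rewrite /= -[v \in t]/(v \in tval t); move: vS; rewrite SE inE => ->.
Qed.

End Isolated.

(** An alternating cochain is determined by its values on one chosen ordering [rep S] of each [S] in
    the support. *)
Lemma card_supported_by (n m : nat) (G : finZmodType) (A : {set {set 'I_n}}) :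
  (#|[set phi : {ffun m.-tuple 'I_n -> G} |
      `[< alternating_cochain phi >] && (face_support phi == A)]| <= #|G| ^ #|A|)%N.
Proof.
pose rep (S : {set 'I_n}) := [pick t : m.-tuple 'I_n | uniq t && ([set x in t] == S)].
pose f (phi : {ffun m.-tuple 'I_n -> G}) : {ffun {set 'I_n} -> G} :=
  [ffun S => if rep S is Some t then phi t else 0].
rewrite -(card_pffun_on 0 (mem A) predT).
rewrite -(card_in_imset (f := f)).
  apply/subset_leq_card/subsetP => h /imsetP [phi].
  rewrite inE => /andP[/asboolP alt /eqP sA] ->.
  apply/pffun_onP; split=> //; apply/subsetP => S.
  rewrite inE /= ffunE /rep; case: pickP => [t /andP[ut /eqP <-] pt|]; last by rewrite eqxx.
  by rewrite -sA mem_face_support.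
move=> phi psi; rewrite !inE => /andP[/asboolP alt1 _] /andP[/asboolP alt2 _] e.
apply/ffunP => t; have [ut|nut] := boolP (uniq t); last by rewrite alt1.1 // alt2.1.
have /ffunP /(_ [set x in t]) := e; rewrite !ffunE /rep.
case: pickP => [t' /andP[ut' /eqP/esym et']|/(_ t)]; last by rewrite ut eqxx.
have [s ->] := same_set_perm ut ut' et'.
by move=> e'; rewrite alt1.2 alt2.2 e'.
Qed.

(** * The random complex *)

Lemma sum_subsets_binomial (R : comNzRingType) (T : finType) (A : {set T}) (p q : R) :
  \sum_(K : {set T} | K \subset A) p ^+ #|K| * q ^+ (#|A| - #|K|) = (p + q) ^+ #|A|.
Proof.
rewrite addrC exprDn (partition_big (fun K : {set T} => inord #|K| : 'I_(#|A|.+1)) xpredT) //=.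
apply: eq_bigr => i _.
rewrite (eq_bigl (fun K : {set T} => (K \subset A) && (#|K| == i))); last first.
  move=> K; case KA: (K \subset A) => //=.
  by rewrite -val_eqE /= inordK // ltnS subset_leq_card.
rewrite (eq_bigr (fun _ => q ^+ (#|A| - i) * p ^+ i)); last first.
  by move=> K /andP[_ /eqP ->]; rewrite mulrC.
by rewrite big_const_seq iter_addr_0 -cards_draws; congr (_ *+ _);
  rewrite -sum1_count sum1dep_card.
Qed.

Section Probability.
Variables (R : realType) (n k : nat) (p : R).
Hypothesis p01 : 0 <= p <= 1.
Notation q := (1 - p).
Notation Om := (ksets n k.+1).
Implicit Types (K B : {set {set 'I_n}}) (E : {set {set 'I_n}} -> bool).

Let p0 : 0 <= p. Proof. by case/andP: p01. Qed.
Let q0 : 0 <= q. Proof. by rewrite subr_ge0; case/andP: p01. Qed.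
Let q1 : q <= 1. Proof. by rewrite lerBlDr lerDl. Qed.

Let wt K : R := p ^+ #|K| * q ^+ ('C(n, k.+1) - #|K|).
Let wt0 K : 0 <= wt K. Proof. by rewrite mulr_ge0 // exprn_ge0. Qed.

Lemma YprobE E : Yprob k p E = \sum_(K : {set {set 'I_n}} | K \subset Om) wt K * (E K)%:R.
Proof.
rewrite /Yprob big_mkcondr /=; apply: eq_bigr => K _.
by case: (E K); rewrite ?mulr1 ?mulr0.
Qed.

Lemma Yprob_le E1 E2 : (forall K, K \subset Om -> E1 K -> E2 K) -> Yprob k p E1 <= Yprob k p E2.
Proof.
move=> le; rewrite !YprobE; apply: ler_sum => K KOm; apply: ler_wpM2l => //.
by have := le K KOm; case: (E1 K) => // /(_ isT) ->.
Qed.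

Lemma Yprob_ge0 E : 0 <= Yprob k p E.
Proof. by rewrite YprobE sumr_ge0 // => K _; rewrite mulr_ge0. Qed.

(** The factor [q ^+ #|B|] comes out of every weight, and what remains is a binomial distribution on
    the subsets of [Om :\: B], of total mass 1. *)
Lemma Yprob_avoid B : B \subset Om ->
  Yprob k p (fun K => [disjoint B & K]) = q ^+ #|B|.
Proof.
move=> BOm; rewrite /Yprob.
have cB : #|Om :\: B| = ('C(n, k.+1) - #|B|)%N.
  by rewrite cardsD (setIidPr BOm) card_ksets.
have lB : (#|B| <= 'C(n, k.+1))%N by rewrite -card_ksets subset_leq_card.
rewrite (eq_bigl (fun K : {set {set 'I_n}} => K \subset Om :\: B)); last first.
  by move=> K; rewrite subsetD disjoint_sym.
have := sum_subsets_binomial (Om :\: B) p q; rewrite subrKC expr1n => e.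
rewrite -[RHS]mulr1 -[X in _ * X]e mulr_sumr; apply: eq_bigr => K KB.
have := subset_leq_card KB; rewrite cB => lK.
rewrite mulrCA -exprD; congr (_ * _ ^+ _); lia.
Qed.

Lemma Yprob_total : Yprob k p (fun _ : {set {set 'I_n}} => true) = 1.
Proof.
rewrite -[RHS](expr0 q) -(cards0 {set 'I_n}) -Yprob_avoid ?sub0set //.
by rewrite !YprobE; apply: eq_bigr => K _; rewrite disjoints_subset sub0set.
Qed.

Lemma Yprob_compl E : Yprob k p (fun K => ~~ E K) = 1 - Yprob k p E.
Proof.
apply/eqP; rewrite eq_sym subr_eq -Yprob_total !YprobE -big_split /=; apply/eqP.
by apply: eq_bigr => K _; case: (E K); rewrite ?mulr1 ?mulr0 ?addr0 ?add0r.
Qed.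

Lemma Yprob_le1 E : Yprob k p E <= 1.
Proof. by rewrite -Yprob_total; apply: Yprob_le. Qed.

Lemma Yprob_union (I : finType) (P : pred I) (E : I -> {set {set 'I_n}} -> bool) :
  Yprob k p (fun K => [exists i in P, E i K]) <= \sum_(i in P) Yprob k p (E i).
Proof.
rewrite YprobE; under [leRHS]eq_bigr do rewrite YprobE.
rewrite [leRHS]exchange_big /=; apply: ler_sum => K _.
rewrite -mulr_sumr ler_wpM2l //.
have [/exists_inP [i Pi Ei]|_] := boolP [exists i in P, E i K]; last exact: sumr_ge0.
by rewrite (bigD1 i) //= Ei lerDl sumr_ge0.
Qed.

(* Second moment method for the number of [S] without cofaces in [K]. *)
Lemma Yprob_no_isolated :
  (k < n)%N -> p < 1 ->
  Yprob k p (fun K => [forall S in ksets n k, ~~ [disjoint cofaces k S & K]]) <=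
  ('C(n, k)%:R * q ^+ (n - k))^-1 + (q^-1 - 1).
Proof.
move=> kn plt1.
have qgt0 : 0 < q by rewrite subr_gt0.
set mu := 'C(n, k)%:R * q ^+ (n - k).
have mu0 : 0 < mu by rewrite mulr_gt0 ?exprn_gt0 // ltr0n bin_gt0 ltnW.
pose X K : R := \sum_(S in ksets n k) [disjoint cofaces k S & K]%:R.
pose Ex (f : {set {set 'I_n}} -> R) := \sum_(K : {set {set 'I_n}} | K \subset Om) wt K * f K.
have cofOm S : cofaces k S \subset Om.
  by apply/subsetP => T; rewrite !inE => /andP[].
have Ex1 : Ex (fun _ => 1) = 1.
  by rewrite -[RHS]Yprob_total YprobE.
have ExX : Ex X = mu.
  rewrite /Ex; under eq_bigr do rewrite mulr_sumr.
  rewrite exchange_big /= (eq_bigr (fun _ => q ^+ (n - k))).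
    by rewrite sumr_const card_ksets /mu mulr_natl.
  move=> S; rewrite inE => /eqP cS.
  by rewrite -YprobE Yprob_avoid // card_cofaces.
have ExX2 : Ex (fun K => X K ^+ 2) <= mu + mu ^+ 2 / q.
  have -> : Ex (fun K => X K ^+ 2) =
     \sum_(S in ksets n k) \sum_(S' in ksets n k) q ^+ #|cofaces k S :|: cofaces k S'|.
    transitivity (\sum_(S in ksets n k) \sum_(S' in ksets n k)
       Yprob k p (fun K => [disjoint cofaces k S :|: cofaces k S' & K])); last first.
      apply: eq_bigr => S _; apply: eq_bigr => S' _.
      by rewrite Yprob_avoid // subUset !cofOm.
    under [RHS]eq_bigr do (under eq_bigr do rewrite YprobE).
    under [RHS]eq_bigr do rewrite exchange_big /=.
    rewrite [RHS]exchange_big /=; apply: eq_bigr => K _.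
    rewrite expr2 /X mulr_suml mulr_sumr; apply: eq_bigr => S _.
    rewrite !mulr_sumr; apply: eq_bigr => S' _.
    by rewrite -natrM mulnb !disjoints_subset subUset.
  have le S : S \in ksets n k -> \sum_(S' in ksets n k) q ^+ #|cofaces k S :|: cofaces k S'| <=
      q ^+ (n - k) + 'C(n, k)%:R * (q ^+ (n - k) * q ^+ (n - k) / q).
    move=> SS; have cS : #|S| = k by move: SS; rewrite inE => /eqP.
    rewrite (bigD1 S) //= setUid card_cofaces // lerD2l.
    rewrite -card_ksets mulr_natl -sumr_const.
    rewrite [leRHS](bigD1 S) //= -[leLHS]add0r lerD //.
      by rewrite mulr_ge0 ?invr_ge0 // mulr_ge0 // exprn_ge0.
    (* Distinct [S] and [S'] share at most one coface, so the union has at least [2 (n - k) - 1]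
       elements; this costs the factor [1 / q]. *)
    apply: ler_sum => S' /andP[]; rewrite inE => /eqP cS' neS.
    rewrite ler_pdivlMr // -exprSr -exprD ler_wiXn2l //.
    have := cardsUI (cofaces k S) (cofaces k S'); rewrite !card_cofaces // => <-.
    rewrite -[leqRHS]addn1 leq_add2l -(cards1 (S :|: S')).
    apply/subset_leq_card/subsetP => T /setIP[TS TS'].
    by rewrite inE (coface_setU cS cS' neS TS TS').
  apply: le_trans (ler_sum _ le) _.
  rewrite sumr_const card_ksets -[leLHS]mulr_natl /mu le_eqVlt; apply/orP; left; apply/eqP.
  field; exact: lt0r_neq0.
have ExB f g : Ex (fun K => f K + g K) = Ex f + Ex g.
  by rewrite /Ex -big_split; apply: eq_bigr => K _; rewrite mulrDr.
have ExZ c f : Ex (fun K => c * f K) = c * Ex f.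
  by rewrite /Ex mulr_sumr; apply: eq_bigr => K _; rewrite mulrCA.
have Exvar : Ex (fun K => (X K - mu) ^+ 2) <= mu + mu ^+ 2 / q - mu ^+ 2.
  have -> : Ex (fun K => (X K - mu) ^+ 2) = Ex (fun K => X K ^+ 2) + (- (2 * mu) * Ex X + mu ^+ 2 * Ex (fun _ => 1)).
    rewrite -!ExZ -!ExB; apply: eq_bigr => K _; congr (_ * _); ring.
  rewrite ExX Ex1; lra.
set PE := Yprob k p _.
(* Chebyshev: on the event [X K = 0], so the squared deviation is [mu ^+ 2]. *)
have cheb : PE * mu ^+ 2 <= Ex (fun K => (X K - mu) ^+ 2).
  rewrite /PE YprobE mulr_suml; apply: ler_sum => K _.
  rewrite -mulrA ler_wpM2l //.
  have [/forall_inP H|_] := boolP [forall S in ksets n k, ~~ [disjoint cofaces k S & K]]; last by rewrite mul0r sqr_ge0.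
  rewrite [X K]big1 ?sub0r ?sqrrN ?mul1r // => S SS.
  by rewrite (negPf (H S SS)).
have := le_trans cheb Exvar; rewrite -ler_pdivlMr ?exprn_gt0 // => /le_trans; apply.
rewrite le_eqVlt; apply/orP; left; apply/eqP.
by field; rewrite !lt0r_neq0.
Qed.

End Probability.

(** * Union bound over cochains of minimal support *)

Section UnionBound.
Variables (R : realType) (G : finZmodType) (n k : nat) (p : R).
Hypothesis p01 : 0 <= p <= 1.
Notation q := (1 - p).
Notation N := 'C(n, k.+1).
Notation cochains := {ffun k.+1.-tuple 'I_n -> G}.
Implicit Types (phi : cochains) (A : {set {set 'I_n}}).

Let q0 : 0 <= q. Proof. by rewrite subr_ge0; case/andP: p01. Qed.
Let q1 : q <= 1. Proof. by rewrite lerBlDr lerDl; case/andP: p01. Qed.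

(** The conditions on a minimal cocycle that do not involve [K]; the remaining one is the event
    whose probability is summed. *)
Definition obstruction phi : bool :=
  `[< [/\ alternating_cochain phi, face_support phi != set0 & minimal_cochain phi] >].

Lemma face_support_ksets m (phi : m.-tuple 'I_n -> G) : face_support phi \subset ksets n m.
Proof. by apply/subsetP => S /card_face_support cS; rewrite inE cS. Qed.

Lemma nonvanishing_union_bound :
  Yprob k.+1 p (fun K : {set {set 'I_n}} =>
    ~~ `[< reduced_cohomology_vanishes (Ycomplex k.+1 K) G k >]) <=
  \sum_(phi : cochains | obstruction phi) q ^+ #|face_support (coboundary phi)|.
Proof.
apply: (@le_trans _ _ (\sum_(phi : cochains | phi \in obstruction)
    Yprob k.+1 p (fun K : {set {set 'I_n}} => [disjoint face_support (coboundary phi) & K]))).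
  apply: le_trans (Yprob_union _ _ _ _) => //; apply: Yprob_le => // K _ /asboolPn.
  case/nonvanishing_minimal => phi [alt nz dis mini].
  apply/exists_inP; exists (finfun phi).
    apply/asboolP; have -> : (finfun phi : k.+1.-tuple 'I_n -> G) = phi by apply/funext => t; rewrite ffunE.
    by split.
  by have -> : (finfun phi : k.+1.-tuple 'I_n -> G) = phi by apply/funext => t; rewrite ffunE.
apply: ler_sum => phi _; rewrite Yprob_avoid //.
exact: face_support_ksets.
Qed.

Lemma sum_by_support (Q : pred {set {set 'I_n}}) (F : cochains -> R) (m : nat) (c : R) :
  0 <= c -> (forall A, Q A -> #|A| = m) ->
  (forall phi, obstruction phi -> Q (face_support phi) -> F phi <= c) ->
  \sum_(phi : cochains | obstruction phi && Q (face_support phi)) F phi <=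
  (#|[set A : {set {set 'I_n}} | (A \subset ksets n k.+1) && Q A]| * #|G| ^ m)%:R * c.
Proof.
move=> c0 Qm Fc.
rewrite (partition_big (fun phi : cochains => face_support phi)
   (mem [set A : {set {set 'I_n}} | (A \subset ksets n k.+1) && Q A])) /=; last first.
  by move=> phi /andP[_ Qphi]; rewrite inE Qphi face_support_ksets.
rewrite natrM -mulrA mulr_natl -sumr_const; apply: ler_sum => A; rewrite inE => /andP[_ QA].
apply: (@le_trans _ _ (\sum_(phi : cochains | `[< alternating_cochain phi >] && (face_support phi == A)) c)).
  rewrite big_mkcond [leRHS]big_mkcond; apply: ler_sum => phi _.
  case: ifP => [/andP[/andP[ob Qp] sA]|_]; last by case: ifP.
  have alt : alternating_cochain phi by case/asboolP: ob.
  by rewrite sA asboolT //=; apply: Fc.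
rewrite sumr_const -[leLHS]mulr_natl ler_wpM2r // ler_nat -(Qm A QA).
by have := card_supported_by k.+1 G A; rewrite cardsE.
Qed.

(** Here the count of sole cofaces is used with [U] the whole support and the trivial degree bound
    [m]. *)
Lemma small_support_sum (m : nat) :
  \sum_(phi : cochains | obstruction phi && (#|face_support phi| == m))
     q ^+ #|face_support (coboundary phi)| <=
  ('C(N, m) * #|G| ^ m)%:R * q ^+ (m * (n - k.+1) - m * m).
Proof.
apply: le_trans (@sum_by_support (fun A => #|A| == m) _ m (q ^+ (m * (n - k.+1) - m * m)) _ _ _) _.
- exact: exprn_ge0.
- by move=> A /eqP.
- move=> phi /asboolP[alt _ _] /eqP cm.
  apply: ler_wiXn2l => //.
  apply: leq_trans (subset_leq_card (sole_cofaces_support alt)).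
  rewrite leq_subLR addnC -{1 2}cm; apply: sole_cofaces_lb => //.
    exact: face_support_ksets.
  by move=> S _; rewrite -cm subset_leq_card ?subsetIr.
- by rewrite (cards_draws (ksets n k.+1)) card_ksets.
Qed.

(** The greedy cover assigns to each support a size [u] of its uncovered part. [W u] stands for any
    bound on [q ^+ b] that follows from the two lower bounds on [b]; counting a cochain under
    several [u] only enlarges the right side. *)
Lemma large_support_sum (m d : nat) (W : nat -> R) :
  (0 < d)%N -> (forall u, 0 <= W u) ->
  (forall u b : nat, (n * m <= k.+2 * b)%N -> (u * (n - k.+1) <= b + m * d)%N -> q ^+ b <= W u) ->
  \sum_(phi : cochains | obstruction phi && (#|face_support phi| == m))
     q ^+ #|face_support (coboundary phi)| <=
  \sum_(u < m.+1) (N ^ (m %/ d).+1 * (2 ^ ((m %/ d).+1 * (k.+1 * n)) * 'C(N, u)) * #|G| ^ m)%:R * W u.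
Proof.
move=> d0 W0 HW.
pose Q u A := (#|A| == m) && [exists s : {ffun 'I_(m %/ d).+1 -> {set 'I_n}},
   [&& [forall i, s i \in ksets n k.+1], #|A :\: covered k.+1 s| == u &
     [forall S in A, #|neighbours k.+1 S :&: (A :\: covered k.+1 s)| <= d]%N]].
apply: (@le_trans _ _ (\sum_(u < m.+1) \sum_(phi : cochains | obstruction phi && Q u (face_support phi))
   q ^+ #|face_support (coboundary phi)|)).
  rewrite [leLHS]big_mkcond /=; under [leRHS]eq_bigr do rewrite big_mkcond /=.
  rewrite exchange_big /=; apply: ler_sum => phi _.
  case: ifP => [/andP[ob cm]|_]; last by apply: sumr_ge0 => u _; case: ifP => // _; apply: exprn_ge0.
  have [alt nz _] := asboolP _ ob.
  have [s [sA deg]] := greedy_cover d0 (face_support_ksets phi) nz.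
  move: s sA deg; rewrite (eqP cm) => s sA deg.
  have ltu : (#|face_support phi :\: covered k.+1 s| < m.+1)%N.
    by move/eqP: (cm) => cm'; rewrite ltnS -[leqRHS]cm' subset_leq_card ?subsetDl.
  rewrite (bigD1 (Ordinal ltu)) //= ob /=.
  have -> : Q #|face_support phi :\: covered k.+1 s| (face_support phi).
    rewrite /Q cm /=; apply/existsP; exists s; apply/and3P; split=> //.
      by apply/forallP => i; apply: (subsetP (face_support_ksets phi)); apply: sA.
    by apply/forall_inP.
  by rewrite lerDl; apply: sumr_ge0 => v _; case: ifP => // _; apply: exprn_ge0.
apply: ler_sum => u _.
apply: le_trans (@sum_by_support (Q u) _ m (W u) _ _ _) _ => //.
- by move=> A /andP[/eqP].
- move=> phi /asboolP[alt _ mini] /andP[/eqP cm /existsP[s /and3P[_ /eqP cu /forall_inP deg]]].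
  apply: HW.
    by rewrite -{1}cm minimal_expansion.
  have := sole_cofaces_lb (face_support_ksets phi) (subsetDl _ _) deg.
  rewrite cu cm => /leq_trans; apply.
  by rewrite leq_add2r subset_leq_card // sole_cofaces_support.
rewrite ler_wpM2r // ler_nat leq_mul2r; apply/orP; right.
apply: leq_trans (card_cover_code n k.+1 (m %/ d).+1 u).
apply/subset_leq_card/subsetP => A; rewrite !inE => /andP[-> /andP[_ /existsP[s /and3P[sk cu _]]]].
by apply/existsP; exists s; rewrite sk.
Qed.

Lemma sum_by_size :
  \sum_(phi : cochains | obstruction phi) q ^+ #|face_support (coboundary phi)| =
  \sum_(1 <= m < N.+1) \sum_(phi : cochains | obstruction phi && (#|face_support phi| == m))
     q ^+ #|face_support (coboundary phi)|.
Proof.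
have z : \sum_(phi : cochains | obstruction phi && (#|face_support phi| == 0)%N)
     q ^+ #|face_support (coboundary phi)| = 0.
  rewrite big1 // => phi /andP[/asboolP[_ nz _]].
  by rewrite cards_eq0 (negPf nz).
transitivity (\sum_(0 <= m < N.+1) \sum_(phi : cochains | obstruction phi && (#|face_support phi| == m))
     q ^+ #|face_support (coboundary phi)|); last by rewrite [LHS]big_ltn // z add0r.
rewrite big_mkord.
rewrite (partition_big (fun phi : cochains => inord #|face_support phi| : 'I_N.+1) xpredT) //=.
apply: eq_bigr => m _; apply: eq_bigl => phi; congr (_ && _).
rewrite -val_eqE /= inordK // ltnS -card_ksets.
by apply: subset_leq_card; apply: face_support_ksets.
Qed.

End UnionBound.

(** * Estimates *)

Section Estimates.
Variable R : realType.
Implicit Types (n m k d N : nat) (p w x : R).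

Lemma onem_expn_le p b : 0 <= p <= 1 -> (1 - p) ^+ b <= expR (- (p * b%:R)).
Proof.
move=> /andP[p0 p1]; rewrite -mulNr expRM_natr lerXn2r ?nnegrE ?expR_ge0 ?subr_ge0 //.
exact: expR_ge1Dx.
Qed.

Lemma ffact_le_expn N m : (N ^_ m <= N ^ m)%N.
Proof.
elim: m => [|m IH]; first by rewrite ffactn0.
by rewrite ffactnSr expnSr leq_mul // leq_subr.
Qed.

Lemma bin_le_expn N m : ('C(N, m) <= N ^ m)%N.
Proof.
apply: leq_trans (ffact_le_expn N m); rewrite -bin_ffact.
by rewrite leq_pmulr // fact_gt0.
Qed.

Lemma natrX_expR N m : (0 < N)%N -> (N ^ m)%:R = expR (m%:R * ln N%:R) :> R.
Proof. by move=> N0; rewrite expRM_natl lnK ?posrE ?ltr0n // natrX. Qed.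

(** This is the bound [(e N / m)^m]; it rests on [m^m / m! <= e^m], one term of the exponential
    series. *)
Lemma bin_le_expR N m : (0 < N)%N -> (0 < m)%N ->
  'C(N, m)%:R <= expR (m%:R * (1 + ln N%:R - ln m%:R)) :> R.
Proof.
move=> N0 m0.
rewrite mulrBr mulrDr mulr1 expRB expRD -!natrX_expR //.
rewrite ler_pdivlMr ?ltr0n ?expn_gt0 ?m0 //.
have := @expR_ge1Dxn R m%:R m.-1 (ler0n _ _); rewrite prednK // => fact_lb.
have {}fact_lb : (m ^ m)%:R <= m`!%:R * expR m%:R :> R.
  rewrite natrX -ler_pdivrMl ?ltr0n ?fact_gt0 // mulrC.
  by apply: le_trans fact_lb; rewrite lerDr.
apply: le_trans (ler_wpM2l (ler0n _ _) fact_lb) _.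
rewrite mulrA -natrM bin_ffact mulrC ler_wpM2l ?expR_ge0 //.
by rewrite ler_nat ffact_le_expn.
Qed.

Lemma ln_nat_bounds n : (0 < n)%N ->
  [/\ 0 <= ln n%:R :> R, ln n%:R <= n%:R :> R & ln n%:R ^+ 2 <= 2 * n%:R :> R].
Proof.
move=> n0; have L0 : 0 <= ln n%:R :> R by rewrite ln_ge0 // ler1n.
have E : expR (ln n%:R) = n%:R :> R by rewrite lnK ?posrE ?ltr0n.
split=> //.
  by have := expR_ge1Dx (ln n%:R : R); rewrite E; lra.
by have := expR_ge1Dxn 1 L0; rewrite E (_ : 2`! = 2)%N //; lra.
Qed.

(* With [d = n / threshold k] the loss [k ln n * (m d / n)] in the exponent is at most
   [m ln n / (4(k+1))], half of what is gained from [u > m / (2(k+1))]. *)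
Definition threshold k : nat := 4 * k * k.+1.

Lemma ln_bin_le n k : (k <= n)%N -> (0 < n)%N ->
  ln ('C(n, k)%:R) <= k%:R * ln n%:R :> R.
Proof.
move=> kn n0; have n0R : 0 < n%:R :> R by rewrite ltr0n.
rewrite mulr_natl -lnXn // ler_ln ?posrE ?exprn_gt0 //.
  by rewrite -natrX ler_nat bin_le_expn.
by rewrite ltr0n bin_gt0.
Qed.

(** Per member of the support the exponent is [1 + ln r + k ln n - ln m - p (n - k - m)]. The terms
    [k ln n] cancel, the loss [k m ln n / n] is absorbed by [ln m] up to [2 k], and [2 (k + m) <= n]
    keeps half of [w]. *)
Lemma small_term_le n k m r p w :
  (0 < k)%N -> (0 < m)%N -> (m <= n %/ threshold k)%N -> (0 < r)%N ->
  0 <= w -> 0 <= p <= 1 -> p = (k%:R * ln n%:R + w) / n%:R ->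
  ('C('C(n, k), m) * r ^ m)%:R * (1 - p) ^+ (m * (n - k) - m * m) <=
  expR (1 + ln r%:R + (k%:R ^+ 2 + 2 * k%:R) - w / 2) ^+ m.
Proof.
move=> k0 m0 md r0 w0 p01 pE.
have mc : (m * threshold k <= n)%N by rewrite (leq_trans _ (leq_trunc_div n (threshold k))) ?leq_mul.
have kmn : (2 * (k + m) <= n)%N by move: mc; rewrite /threshold; nia.
have kmn' : (2 * (k * m) <= n)%N by move: mc; rewrite /threshold; nia.
have n0 : (0 < n)%N by lia.
have kn : (k <= n)%N by lia.
have mnk : (m <= n - k)%N by lia.
have [L0 Ln L2] := ln_nat_bounds n0.
have n0R : 0 < n%:R :> R by rewrite ltr0n.
have k1R : 1 <= k%:R :> R by rewrite ler1n.
have m0R : 0 < m%:R :> R by rewrite ltr0n.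
have {}kmn : 2 * (k%:R + m%:R) <= n%:R :> R by rewrite -natrD -natrM ler_nat.
have {}kmn' : 2 * (k%:R * m%:R) <= n%:R :> R by rewrite -!natrM ler_nat.
have N0 : (0 < 'C(n, k))%N by rewrite bin_gt0.
have lnN := ln_bin_le kn n0.
set L := ln n%:R in pE L0 Ln L2 lnN.
set l := L / n%:R; set v := w / n%:R.
have lE : l * n%:R = L by rewrite /l mulfVK ?gt_eqF.
have vE : v * n%:R = w by rewrite /v mulfVK ?gt_eqF.
have l0 : 0 <= l by rewrite divr_ge0 // ltW.
have v0 : 0 <= v by rewrite divr_ge0 // ltW.
have l1 : l <= 1 by rewrite ler_pdivrMr // mul1r.
have {}pE : p = k%:R * l + v by rewrite pE mulrDl mulrA.
clearbody l v.
(* For [m^2 <= n] the bound [(ln n)^2 <= 2 n] gives [m l <= 2]. Otherwise [ln n <= 2 ln m], while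
   [2 k m <= n] bounds the left side by [ln n / 2]. *)
have lm : k%:R * (m%:R * l) <= ln m%:R + 2 * k%:R.
  have lnm : 0 <= ln m%:R :> R by rewrite ln_ge0 // ler1n.
  have [mn|nm] := leqP (m ^ 2) n.
    have ml : m%:R * l <= 2.
      rewrite -(@ler_pXn2r _ 2) ?nnegrE //; last by rewrite mulr_ge0 // ltW.
      have mnR : m%:R ^+ 2 <= n%:R :> R by rewrite -natrX ler_nat.
      have : n%:R * l ^+ 2 <= 2.
        by rewrite -(ler_pM2r n0R); move: L2; rewrite -lE; lra.
      have := ler_wpM2r (sqr_ge0 l) mnR; rewrite exprMn; lra.
    by nra.
  have : L <= 2 * ln m%:R.
    rewrite mulr_natl -lnXn // ler_ln ?posrE ?exprn_gt0 //.
    by rewrite -natrX ler_nat ltnW.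
  have : k%:R * (m%:R * l) * 2 <= L by rewrite -lE; nra.
  by nra.
have -> : (m * (n - k) - m * m = m * (n - k - m))%N by rewrite -mulnBr.
have bE : (m * (n - k - m))%:R = m%:R * (n%:R - k%:R - m%:R) :> R.
  by rewrite natrM (natrB _ mnk) (natrB _ kn).
have rE : (r ^ m)%:R <= expR (m%:R * ln r%:R) :> R by rewrite (natrX_expR m r0) lexx.
rewrite natrM.
have cE := bin_le_expR N0 m0.
apply: le_trans (ler_pM _ _ (ler_pM _ _ cE rE) (onem_expn_le _ p01)) _;
  rewrite ?mulr_ge0 ?expR_ge0 ?exprn_ge0 //; first by rewrite subr_ge0; case/andP: p01.
rewrite -!expRD -expRM_natl ler_expR bE.
have -> : - (p * (m%:R * (n%:R - k%:R - m%:R))) = m%:R * - (p * (n%:R - k%:R - m%:R)) by ring.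
rewrite -!mulrDr ler_pM2l //.
have -> : p * (n%:R - k%:R - m%:R) = k%:R * L + w - (k%:R ^+ 2 * l + k%:R * (m%:R * l)) - v * (k%:R + m%:R).
  by rewrite pE -lE -vE; ring.
have : v * (k%:R + m%:R) * 2 <= w by rewrite -vE -mulrA ler_wpM2l // mulrC.
have : k%:R ^+ 2 * l <= k%:R ^+ 2 by rewrite ler_piMr // sqr_ge0.
lra.
Qed.

End Estimates.

(** * Exponents for large supports *)

Section LargeEstimate.
Variable R : realType.

(* [(k ln n / n) * b], with [b] replaced by the larger of its two lower bounds. *)
Definition log_weight (n k m d u : nat) : R :=
  k%:R * (ln n%:R / n%:R) *
    Num.max (n%:R * m%:R / k.+1%:R) (u%:R * (n%:R - k%:R) - m%:R * d%:R).

(** The summands pay, per member of the support, for the values in [G], for the centres and the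
    covered subset ([4 c k] each, [c] the threshold), for the uncovered rest, and for the number of
    values of [u]. *)
Definition large_const (k r : nat) : R :=
  ln r%:R + 8 * (threshold k)%:R * k%:R + (1 + ln (2 * k.+1 * threshold k)%:R) + k%:R ^+ 2 + 1.

(** For [2 (k+1) u <= m] at least half of the weight [k m ln n / (k+1)] survives. Otherwise the gain
    [u ln n] exceeds [m ln n / (2 (k+1))], and the term with [d] takes back at most half of that. *)
Lemma large_bin_weight_le n k m u :
  (0 < k)%N -> (threshold k <= n)%N -> (n %/ threshold k < m)%N -> (u <= m)%N ->
  'C('C(n, k), u)%:R * expR (- log_weight n k m (n %/ threshold k) u) <=
  expR (m%:R * ((1 + ln (2 * k.+1 * threshold k)%:R) + k%:R ^+ 2 - ln n%:R / (4 * k.+1%:R))) :> R.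
Proof.
move=> k0 cn dm um; set c := threshold k in cn dm *; set d := (n %/ c)%N in dm *.
have c0 : (0 < c)%N by rewrite /c /threshold; lia.
have kn : (k <= n)%N by move: cn; rewrite /c /threshold; nia.
have n0 : (0 < n)%N by lia.
have [L0 Ln _] := ln_nat_bounds R n0.
have lnN := @ln_bin_le R n k kn n0.
have n0R : 0 < n%:R :> R by rewrite ltr0n.
have k1R : 1 <= k%:R :> R by rewrite ler1n.
have ks : k.+1%:R = k%:R + 1 :> R by rewrite -natr1.
have cE : c%:R = 4 * k%:R * (k%:R + 1) :> R by rewrite /c /threshold !natrM ks.
clearbody c.
have C0 : 0 < (2 * k.+1 * c)%:R :> R by rewrite ltr0n !muln_gt0.
have lc0 : 0 <= ln (2 * k.+1 * c)%:R :> R by rewrite ln_ge0 // ler1n; lia.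
rewrite /log_weight ks; set lc := ln (2 * k.+1 * c)%:R in lc0 *; set L := ln n%:R in L0 Ln lnN *.
set l := L / n%:R.
have lE : l * n%:R = L by rewrite /l mulfVK ?gt_eqF.
have l0 : 0 <= l by rewrite divr_ge0 // ltW.
have l1 : l <= 1 by rewrite ler_pdivrMr // mul1r.
have m0R : 0 <= m%:R :> R by [].
have umR : u%:R <= m%:R :> R by rewrite ler_nat.
have iE : (k%:R + 1) * (k%:R + 1)^-1 = 1 :> R by rewrite mulfV // gt_eqF //; lra.
have iE4 : L / (4 * (k%:R + 1)) = L * (k%:R + 1)^-1 / 4 by rewrite invfM mulrA [RHS]mulrAC.
rewrite iE4; set i := (k%:R + 1)^-1 in iE *.
have i0 : 0 < i by rewrite invr_gt0; lra.
set M := Num.max _ _.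
have M1 : n%:R * m%:R * i <= M by rewrite le_max lexx.
have M2 : u%:R * (n%:R - k%:R) - m%:R * d%:R <= M by rewrite le_max lexx orbT.
have kl0 : 0 <= k%:R * l by rewrite mulr_ge0.
have [small|big] := leqP (2 * k.+1 * u) m.
  have N0 : (0 < 'C(n, k))%N by rewrite bin_gt0.
  apply: (@le_trans _ _ (expR (u%:R * (k%:R * L)) * expR (- (k%:R * l * (n%:R * m%:R * i))))).
    apply: ler_pM; rewrite ?expR_ge0 ?ler_expR ?lerN2 ?ler_wpM2l //.
    apply: le_trans (_ : ('C(n, k) ^ u)%:R <= _); first by rewrite ler_nat bin_le_expn.
    by rewrite natrX_expR // ler_expR ler_wpM2l.
  rewrite -expRD ler_expR.
  have smallR : 2 * u%:R <= m%:R * i.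
    rewrite (_ : 2 * u%:R = 2 * u%:R * (k%:R + 1) * i) ?ler_wpM2r ?(ltW i0) //; last by rewrite -mulrA iE mulr1.
    by rewrite mulrAC -ks -!natrM ler_nat.
  have -> : k%:R * l * (n%:R * m%:R * i) = k%:R * L * (m%:R * i) by rewrite -lE; ring.
  have kL : 0 <= k%:R * L by rewrite mulr_ge0.
  have := ler_wpM2l kL smallR.
  have : L * (m%:R * i) <= k%:R * L * (m%:R * i).
    by rewrite ler_wpM2r ?(mulr_ge0 m0R (ltW i0)) // ler_peMl.
  have : 0 <= m%:R * (1 + lc + k%:R ^+ 2) by rewrite mulr_ge0 // !addr_ge0 // sqr_ge0.
  have : 0 <= L * (m%:R * i) by rewrite mulr_ge0 // mulr_ge0 // ltW.
  lra.
have u0 : (0 < u)%N by rewrite lt0n; apply: contraTneq big => ->; rewrite muln0.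
have u0R : 0 < u%:R :> R by rewrite ltr0n.
(* Both [n < m c] and [m < 2 (k+1) u] hold here, so [u] is a constant fraction of [n]; the
   denominator [u^u] in the binomial bound then saves a factor of order [n] per element. *)
have lnu : L - lc <= ln u%:R.
  rewrite lerBlDr /lc -(lnM u0R C0) ler_ln ?posrE ?(mulr_gt0 u0R C0) //.
  rewrite -natrM ler_nat.
  have nmc : (n < m * c)%N by rewrite -ltn_divLR.
  by rewrite (leq_trans (ltnW nmc)) // mulnA leq_mul2r mulnC (ltnW big) orbT.
have N0 : (0 < 'C(n, k))%N by rewrite bin_gt0.
apply: (@le_trans _ _ (expR (u%:R * (1 + k%:R * L - (L - lc))) *
    expR (- (k%:R * l * (u%:R * (n%:R - k%:R) - m%:R * d%:R))))).
  apply: ler_pM; rewrite ?expR_ge0 ?ler_expR ?lerN2 ?ler_wpM2l //.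
  apply: le_trans (bin_le_expR R N0 u0) _.
  by rewrite ler_expR ler_wpM2l //; lra.
rewrite -expRD ler_expR.
have bigR : m%:R * i <= 2 * u%:R.
  rewrite (_ : 2 * u%:R = 2 * u%:R * (k%:R + 1) * i) ?ler_wpM2r ?(ltW i0) //; last by rewrite -mulrA iE mulr1.
  by rewrite mulrAC -ks -!natrM ler_nat ltnW.
have dR : d%:R * c%:R <= n%:R :> R by rewrite -natrM ler_nat leq_trunc_div.
have kld : k%:R * l * (m%:R * d%:R) <= L * (m%:R * i) / 4.
  have -> : L * (m%:R * i) / 4 = m%:R * l * i / 4 * n%:R by rewrite -lE; ring.
  have -> : k%:R * l * (m%:R * d%:R) = m%:R * l * i / 4 * (d%:R * c%:R).
    rewrite cE; transitivity (k%:R * l * (m%:R * d%:R) * ((k%:R + 1) * i)); first by rewrite iE mulr1.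
    by field.
  by rewrite ler_wpM2l // !mulr_ge0 // ltW.
have -> : k%:R * l * (u%:R * (n%:R - k%:R) - m%:R * d%:R) =
   u%:R * (k%:R * L) - u%:R * (k%:R ^+ 2 * l) - k%:R * l * (m%:R * d%:R).
  by rewrite -lE; ring.
have : u%:R * (k%:R ^+ 2 * l) <= m%:R * k%:R ^+ 2.
  by rewrite ler_pM // ?mulr_ge0 ?sqr_ge0 // ler_piMr // sqr_ge0.
have : u%:R * (1 + lc) <= m%:R * (1 + lc) by rewrite ler_wpM2r // addr_ge0.
have := ler_wpM2l L0 bigR.
lra.
Qed.

(** With [s] centres, [s d <= 2 m] and [n <= 2 d c] for the threshold [c], so [s n <= 4 c m]. Hence
    choosing centres and covered subset costs only [exp(O(m))], even with the crude [ln n <= n]; the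
    [m + 1] values of [u] cost at most [e^m]. *)
Lemma large_sum_le n k m r d :
  (0 < k)%N -> (threshold k <= n)%N -> (n %/ threshold k < m)%N -> (0 < r)%N ->
  d = (n %/ threshold k)%N ->
  \sum_(u < m.+1)
    ('C(n, k) ^ (m %/ d).+1 * (2 ^ ((m %/ d).+1 * (k * n)) * 'C('C(n, k), u)) * r ^ m)%:R *
    expR (- log_weight n k m d u) <=
  expR (large_const k r - ln n%:R / (4 * k.+1%:R)) ^+ m.
Proof.
move=> k0 cn dm r0 dE; rewrite -dE in dm.
have c0 : (0 < threshold k)%N by rewrite /threshold; lia.
have d0 : (0 < d)%N by rewrite dE divn_gt0.
have kn : (k <= n)%N by move: cn; rewrite /threshold; nia.
have n0 : (0 < n)%N by lia.
have [L0 Ln _] := ln_nat_bounds R n0.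
have lnN := @ln_bin_le R n k kn n0.
have k1R : 1 <= k%:R :> R by rewrite ler1n.
pose s := (m %/ d).+1.
have sn : (s * n <= 4 * threshold k * m)%N.
  have h1 : (s * d <= 2 * m)%N.
    by rewrite /s mulSn; have := leq_trunc_div m d; move: dm; lia.
  have h2 : (n <= 2 * (d * threshold k))%N.
    by have := divn_eq n (threshold k); have := ltn_pmod n c0; rewrite -dE; nia.
  apply: leq_trans (leq_mul (leqnn s) h2) _.
  have -> : (s * (2 * (d * threshold k)) = 2 * threshold k * (s * d))%N by ring.
  have -> : (4 * threshold k * m = 2 * threshold k * (2 * m))%N by ring.
  by rewrite leq_mul2l h1 orbT.
have N0 : (0 < 'C(n, k))%N by rewrite bin_gt0.
have codeE : ('C(n, k) ^ s)%:R <= expR (m%:R * (4 * (threshold k)%:R * k%:R)) :> R.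
  rewrite natrX_expR // ler_expR.
  apply: (@le_trans _ _ (s%:R * (k%:R * n%:R))).
    by rewrite ler_wpM2l // (le_trans lnN) // ler_wpM2l.
  have : (s * n)%:R <= (4 * threshold k * m)%:R :> R by rewrite ler_nat.
  rewrite !natrM => h; have := ler_wpM2l (ler0n R k) h; lra.
have subE : (2 ^ (s * (k * n)))%:R <= expR (m%:R * (4 * (threshold k)%:R * k%:R)) :> R.
  apply: (@le_trans _ _ (expR ((s * (k * n))%:R))).
    rewrite -[X in expR X]mulr1 expRM_natl natrX lerXn2r ?nnegrE ?expR_ge0 //.
    by have := expR_ge1Dx (1 : R); lra.
  rewrite ler_expR.
  have : (s * n)%:R <= (4 * threshold k * m)%:R :> R by rewrite ler_nat.
  rewrite !natrM => h; have := ler_wpM2l (ler0n R k) h; lra.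
set T := expR (m%:R * ((1 + ln (2 * k.+1 * threshold k)%:R) + k%:R ^+ 2 - ln n%:R / (4 * k.+1%:R))) : R.
set E := expR (m%:R * (4 * (threshold k)%:R * k%:R)) in codeE subE.
apply: (@le_trans _ _ (\sum_(u < m.+1) E * E * expR (m%:R * ln r%:R) * T)).
  apply: ler_sum => u _.
  have um : (u <= m)%N by rewrite -ltnS.
  have := @large_bin_weight_le n k m u k0 cn _ um; rewrite -dE -/T => /(_ dm) le.
  rewrite -/s !natrM (natrX_expR R m r0).
  set B := 'C(_, u)%:R in le *; set V := expR (- _) in le *; set Q := expR (m%:R * ln _).
  rewrite (_ : _ * V = ('C(n, k) ^ s)%:R * (2 ^ (s * (k * n)))%:R * Q * (B * V)); last by ring.
  apply: ler_pM => //; rewrite ?mulr_ge0 ?expR_ge0 ?ler0n //.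
  apply: ler_pM; rewrite ?mulr_ge0 ?expR_ge0 ?ler0n //.
  by apply: ler_pM.
rewrite sumr_const card_ord -[leLHS]mulr_natl.
apply: (@le_trans _ _ (expR m%:R * (E * E * expR (m%:R * ln r%:R) * T))).
  rewrite ler_wpM2r ?mulr_ge0 ?expR_ge0 // -natr1 addrC; exact: expR_ge1Dx.
rewrite /E /T -!expRD -expRM_natl ler_expR /large_const le_eqVlt; apply/orP; left; apply/eqP.
by field; rewrite addrC natr1 pnatr_eq0.
Qed.

End LargeEstimate.

(** * Asymptotics *)

Local Open Scope classical_set_scope.
Local Open Scope ring_scope.

Section Asymptotics.
Variable R : realType.

Lemma geometric_sum_le (x : R) M : 0 <= x -> x <= 2^-1 ->
  \sum_(1 <= m < M.+1) x ^+ m <= 2 * x.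
Proof.
move=> x0 xh.
suff E : (1 - x) * \sum_(1 <= m < M.+1) x ^+ m = x - x ^+ M.+1.
  have S0 : 0 <= \sum_(1 <= m < M.+1) x ^+ m by apply: sumr_ge0 => i _; apply: exprn_ge0.
  have : 0 <= x ^+ M.+1 by exact: exprn_ge0.
  by nra.
elim: M => [|M IH]; first by rewrite big_geq // mulr0 expr1 subrr.
by rewrite big_nat_recr //= mulrDr IH [x ^+ M.+2]exprS; ring.
Qed.

Definition small_const (k r : nat) : R := 1 + ln r%:R + (k%:R ^+ 2 + 2 * k%:R).

(** Small and large [m] are both dominated by the [m]-th power of the sum of the two exponentials.
    The bounds [4^-1] make this ratio at most one half, so one geometric series suffices. *)
Lemma nonvanishing_prob_le (G : finZmodType) (n k : nat) (p w : R) :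
  (threshold k.+1 <= n)%N -> 0 <= w -> 0 <= p <= 1 ->
  p = (k.+1%:R * ln n%:R + w) / n%:R ->
  expR (small_const k.+1 #|G| - w / 2) <= 4^-1 ->
  expR (large_const R k.+1 #|G| - ln n%:R / (4 * k.+2%:R)) <= 4^-1 ->
  1 - Pr_Hkm1_vanishes G n k.+1 p <=
  2 * (expR (small_const k.+1 #|G| - w / 2) +
       expR (large_const R k.+1 #|G| - ln n%:R / (4 * k.+2%:R))).
Proof.
move=> cn w0 p01 pE; set x1 := expR _; set x2 := expR _ => x1h x2h.
have r0 : (0 < #|G|)%N by apply/card_gt0P; exists 0.
have kn : (k.+1 <= n)%N by move: cn; rewrite /threshold; nia.
have n0 : (0 < n)%N by lia.
have c0 : (0 < threshold k.+1)%N by rewrite /threshold; lia.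
have n0R : 0 < n%:R :> R by rewrite ltr0n.
have x10 : 0 <= x1 by exact: expR_ge0.
have x20 : 0 <= x2 by exact: expR_ge0.
rewrite /Pr_Hkm1_vanishes /= -Yprob_compl //.
apply: le_trans (nonvanishing_union_bound G n k p01) _.
rewrite sum_by_size; apply: le_trans (geometric_sum_le 'C(n, k.+1) _ _); last 2 first.
- exact: addr_ge0.
- by lra.
apply: ler_sum_nat => m /andP[m0 _].
have [small|large] := leqP m (n %/ threshold k.+1).
  apply: le_trans (small_support_sum G n k p01 m) _.
  apply: le_trans (small_term_le _ m0 small r0 w0 p01 pE) _ => //.
  by apply: lerXn2r; rewrite ?nnegrE ?addr_ge0 // lerDl.
apply: (@le_trans _ _ (x2 ^+ m)); last first.
  by apply: lerXn2r; rewrite ?nnegrE ?addr_ge0 // lerDr.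
have d0 : (0 < n %/ threshold k.+1)%N by rewrite divn_gt0.
have lsum := @large_sum_le R n k.+1 m #|G| _ (ltn0Sn k) cn large r0 erefl.
apply: le_trans (@large_support_sum R G n k p p01 m _
  (fun u => expR (- log_weight R n k.+1 m (n %/ threshold k.+1) u)) d0 _ _) lsum.
  by move=> u; exact: expR_ge0.
(* Only the part [k.+1 ln n / n] of [p] enters the weight, and [b] dominates both arguments of its
   maximum. *)
move=> u b h1 h2; apply: le_trans (onem_expn_le _ p01) _.
rewrite ler_expR lerN2 /log_weight.
have L0 : 0 <= ln n%:R :> R by rewrite ln_ge0 // ler1n.
apply: (@le_trans _ _ (k.+1%:R * (ln n%:R / n%:R) * b%:R)).
  rewrite ler_wpM2l ?mulr_ge0 ?invr_ge0 // ge_max; apply/andP; split.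
    by rewrite ler_pdivrMr ?ltr0n // -!natrM ler_nat [leqRHS]mulnC.
  by rewrite lerBlDr -(natrB _ kn) -!natrM -natrD ler_nat.
by rewrite ler_wpM2r // pE mulrDl mulrA lerDl divr_ge0 // ltW.
Qed.

Lemma expn_le_ffact n k : (2 * k <= n)%N -> (n ^ k <= 2 ^ k * n ^_ k)%N.
Proof.
elim: k => [|k IH] kn; first by rewrite ffactn0.
rewrite expnSr expnS ffactnSr.
have -> : (2 * 2 ^ k * (n ^_ k * (n - k)) = 2 ^ k * n ^_ k * (2 * (n - k)))%N by ring.
by apply: leq_mul; [apply: IH; lia|lia].
Qed.

(** Since [1 / (1 - p) = 1 + p / (1 - p)], it is enough that [p / (1 - p) <= p + 2 p^2]. *)
Lemma onem_ge_expR (p : R) : 0 <= p -> p <= 2^-1 -> expR (- (p + 2 * p ^+ 2)) <= 1 - p.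
Proof.
move=> p0 ph; have q0 : 0 < 1 - p by lra.
rewrite expRN -[leRHS]invrK lef_pV2 ?posrE ?expR_gt0 ?invr_gt0 //.
have -> : (1 - p)^-1 = 1 + p / (1 - p) by field; rewrite gt_eqF.
apply: le_trans (expR_ge1Dx _) _; rewrite ler_expR ler_pdivrMr //.
by nra.
Qed.

(** The first two terms come from [binom(n,k) >= (n/2)^k / k!], the last from [2 p^2 n <= 4 k^2]. *)
Definition isolated_const (k : nat) : R := k%:R * ln 2 + ln k`!%:R + 4 * k%:R ^+ 2.

Lemma expected_isolated_ge (n k : nat) (p w : R) :
  (0 < k)%N -> (2 * k <= n)%N -> 0 <= w -> 0 <= p -> p <= 2^-1 ->
  p = (k%:R * ln n%:R - w) / n%:R ->
  expR (w - isolated_const k) <= 'C(n, k)%:R * (1 - p) ^+ (n - k).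
Proof.
move=> k0 kn w0 p0 ph pE.
have n0 : (0 < n)%N by lia.
have [L0 _ L2] := ln_nat_bounds R n0.
have n0R : 0 < n%:R :> R by rewrite ltr0n.
set L := ln n%:R in pE L0 L2.
have pn : p * n%:R = k%:R * L - w by rewrite pE mulfVK ?gt_eqF.
have p2n : p ^+ 2 * n%:R <= 2 * k%:R ^+ 2.
  rewrite -(ler_pM2r n0R).
  have -> : p ^+ 2 * n%:R * n%:R = (p * n%:R) ^+ 2 by ring.
  apply: (@le_trans _ _ ((k%:R * L) ^+ 2)).
    rewrite lerXn2r ?nnegrE ?mulr_ge0 // ?(ltW n0R) //.
    by rewrite pn lerBlDr lerDl.
  rewrite exprMn; have := ler_wpM2l (sqr_ge0 (k%:R : R)) L2; lra.
have Cge : expR (k%:R * L - (k%:R * ln 2 + ln k`!%:R)) <= 'C(n, k)%:R.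
  have f0 : 0 < k`!%:R :> R by rewrite ltr0n fact_gt0.
  rewrite expRB expRD !expRM_natl !lnK ?posrE // ler_pdivrMr ?mulr_gt0 ?exprn_gt0 //.
  rewrite mulrCA -natrM bin_ffact -!natrX -natrM ler_nat.
  exact: expn_le_ffact.
have qge : expR (- (k%:R * L - w) - 4 * k%:R ^+ 2) <= (1 - p) ^+ (n - k).
  apply: (@le_trans _ _ ((1 - p) ^+ n)); last first.
    by apply: ler_wiXn2l; rewrite ?leq_subr //; lra.
  apply: (@le_trans _ _ (expR (- (p + 2 * p ^+ 2)) ^+ n)); last first.
    by rewrite lerXn2r ?nnegrE ?expR_ge0 ?onem_ge_expR //; lra.
  rewrite -expRM_natl ler_expR.
  have -> : n%:R * - (p + 2 * p ^+ 2) = - (p * n%:R) - 2 * (p ^+ 2 * n%:R) by ring.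
  by rewrite pn; lra.
apply: le_trans (ler_pM _ _ Cge qge); rewrite ?expR_ge0 // -expRD ler_expR /isolated_const.
lra.
Qed.

(** Vanishing excludes isolated sets. In the second moment bound the inverse mean gives the
    exponential, and [1 / (1 - p) - 1 <= 2 p] for [p <= 1/2]. *)
Lemma vanishing_prob_le (G : finZmodType) (n k : nat) (p w : R) :
  (1 < #|G|)%N -> (2 * k.+1 <= n)%N -> 0 <= w -> 0 <= p -> p <= 2^-1 ->
  p = (k.+1%:R * ln n%:R - w) / n%:R ->
  Pr_Hkm1_vanishes G n k.+1 p <= expR (isolated_const k.+1 - w) + 2 * p.
Proof.
move=> G1 kn w0 p0 ph pE.
have p01 : 0 <= p <= 1 by rewrite p0 /=; lra.
have [g g0] : exists g : G, g != 0.
  have : (0 < #|[set~ (0%R : G)]%SET|)%N by rewrite cardsC1; case: #|G| G1 => [|[|]].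
  by case/card_gt0P => g; rewrite !inE => g0; exists g.
have kn' : (k.+1 < n)%N by lia.
apply: (@le_trans _ _ (Yprob k.+1 p (fun K : {set {set 'I_n}} =>
    [forall S in ksets n k.+1, ~~ [disjoint cofaces k.+1 S & K]]))).
  apply: (Yprob_le p01) => K KOm /asboolP van; apply/forall_inP => S; rewrite inE => /eqP cS.
  apply/negP => dis; apply: (isolated_nonvanishing g0 cS kn' _ van) => T TK.
  apply/negP => ST; have := disjointFl dis TK; rewrite inE ST andbT.
  by have := subsetP KOm T TK; rewrite inE => ->.
apply: le_trans (Yprob_no_isolated p01 kn' _) _; first by lra.
have q0 : 0 < 1 - p by lra.
apply: lerD.
  rewrite -[X in _ <= expR X]opprB expRN lef_pV2 ?posrE ?expR_gt0 //.
    exact: expected_isolated_ge.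
  by rewrite mulr_gt0 ?exprn_gt0 // ltr0n bin_gt0 ltnW.
rewrite lerBlDr -div1r ler_pdivrMr //; nra.
Qed.

Lemma near_ln_ge (A : R) : \forall n \near \oo, A <= ln n%:R.
Proof.
near=> n.
have n0 : (0 : R) < n%:R by apply: lt_le_trans (expR_gt0 A) _; near: n; exact: nbhs_infty_ger.
rewrite -ler_expR lnK ?posrE //.
by near: n; exact: nbhs_infty_ger.
Unshelve. all: by end_near. Qed.

Lemma expR_le_of_ge (e C t : R) : 0 < e -> C - ln e <= t -> expR (C - t) <= e.
Proof. by move=> e0 h; rewrite -[leRHS](lnK (x := e)) ?posrE // ler_expR; lra. Qed.


(** From [(ln n)^2 <= 2 n] follows [k ln n / n <= 2 k / ln n]. *)
Lemma edge_prob_small (n k : nat) (w e : R) :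
  (0 < n)%N -> 0 <= w -> 0 < e -> 2 * k%:R / e + 1 <= ln n%:R ->
  (k%:R * ln n%:R - w) / n%:R <= e.
Proof.
move=> n0 w0 e0 Lge; have [L0 _ L2] := ln_nat_bounds R n0.
have n0R : 0 < n%:R :> R by rewrite ltr0n.
have k0 : 0 <= k%:R :> R by [].
have ke : 2 * k%:R <= e * ln n%:R.
  by rewrite [leRHS]mulrC -ler_pdivrMr //; lra.
have Lp : 0 < ln n%:R :> R.
  apply: lt_le_trans Lge; have : 0 <= 2 * k%:R / e by rewrite divr_ge0 ?mulr_ge0 // ltW.
  lra.
rewrite ler_pdivrMr // -(ler_pM2r Lp).
nra.
Qed.

End Asymptotics.

Theorem theorem1p1 (R : realType) (k : nat) (G : finZmodType) (omega : nat -> R) :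
  (1 <= k)%N -> (1 < #|G|)%N ->
  omega n @[n --> \oo] --> +oo ->
  ((\forall n \near \oo,
       0 <= (k%:R * ln n%:R - omega n) / n%:R <= 1) ->
     Pr_Hkm1_vanishes G n k ((k%:R * ln n%:R - omega n) / n%:R) @[n --> \oo] --> (0 : R))
  /\
  ((\forall n \near \oo,
       0 <= (k%:R * ln n%:R + omega n) / n%:R <= 1) ->
     Pr_Hkm1_vanishes G n k ((k%:R * ln n%:R + omega n) / n%:R) @[n --> \oo] --> (1 : R)).
Proof.
case: k => // k _ G1 /cvgryPge omega_ge.
split=> p01; apply/cvgrPdist_le => e e0.
- near=> n.
  have w0 : 0 <= omega n by near: n; exact: omega_ge.
  have pn : 0 <= (k.+1%:R * ln n%:R - omega n) / n%:R <= 1 by near: n.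
  have nk : (2 * k.+1 <= n)%N by near: n; exact: nbhs_infty_ge.
  have [p0 _] := andP pn.
  have n0 : (0 < n)%N by lia.
  have ph : (k.+1%:R * ln n%:R - omega n) / n%:R <= 2^-1.
    by apply: edge_prob_small => //; near: n; exact: near_ln_ge.
  have pe : (k.+1%:R * ln n%:R - omega n) / n%:R <= e / 4.
    by apply: edge_prob_small; rewrite ?divr_gt0 //; near: n; exact: near_ln_ge.
  rewrite sub0r normrN ger0_norm; last exact: Yprob_ge0.
  apply: le_trans (vanishing_prob_le G1 nk w0 p0 ph erefl) _.
  have xe : expR (isolated_const R k.+1 - omega n) <= e / 2.
    by apply: expR_le_of_ge; rewrite ?divr_gt0 //; near: n; exact: omega_ge.
  lra.
- have [e1 [e10 e1e e14]] : exists e1 : R, [/\ 0 < e1, 4 * e1 <= e & e1 <= 4^-1].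
    (* The final bound is [2 (e1 + e1)], hence [e / 4]; the cap [4^-1] is what the geometric series
       requires. *)
    exists (Num.min (e / 4) 4^-1); rewrite lt_min !divr_gt0 //= ?invr_gt0 //.
    split=> //; last by rewrite ge_min lexx orbT.
    by rewrite mulrC -ler_pdivlMr // ge_min lexx.
  near=> n.
  have w0 : 0 <= omega n by near: n; exact: omega_ge.
  have pn : 0 <= (k.+1%:R * ln n%:R + omega n) / n%:R <= 1 by near: n.
  have cn : (threshold k.+1 <= n)%N by near: n; exact: nbhs_infty_ge.
  have x1 : expR (small_const R k.+1 #|G| - omega n / 2) <= e1.
    apply: expR_le_of_ge => //; rewrite ler_pdivlMr //.
    by near: n; exact: omega_ge.
  have x2 : expR (large_const R k.+1 #|G| - ln n%:R / (4 * k.+2%:R)) <= e1.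
    apply: expR_le_of_ge => //; rewrite ler_pdivlMr ?mulr_gt0 ?ltr0n //.
    by near: n; exact: near_ln_ge.
  rewrite ger0_norm ?subr_ge0 ?Yprob_le1 //.
  apply: le_trans (nonvanishing_prob_le cn w0 pn erefl (le_trans x1 e14) (le_trans x2 e14)) _.
  lra.
Unshelve. all: by end_near. Qed.
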